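(* Let $n \in \mathbb{N}$. Uniformly in $c \in \mathrm{CompStr}$, we have that (a) $\mathrm{ACL}^c_{n}$ is a $\Sigma^0_{n+2}$ set, and (b) $\mathrm{DCL}^c_{n}$ is a $\Delta^0_{n+2}$ set. Further, uniformly in $c\in\mathrm{CompStr}$ and in a computable collection $\Phi$ of first-order $\mathcal{L}_c$-formulas of quantifier rank at most $n$, we have that (c) $\mathrm{acl}_{\Phi, c}$ is a $\Sigma^0_{n+2}$ set, and (d) $\mathrm{dcl}_{\Phi, c}$ is a $\Sigma^0_{n+2}$ set.
   Context: Computable structures. Languages are relational and may be many-sorted: $\mathcal{L} = ((X_j)_{j\in J}, (R_i)_{i\in I})$ with sorts $X_j$ and relation symbols $R_i$, where $I,J\in\mathbb{N}\cup\{\mathbb{N}\}$ (a natural number is identified with the set of its predecessors). The type of a tuple of elements or variables is the product of the sorts of its entries, in order; the type of a relation symbol is a finite product of sorts. $\mathcal{L}$ is computable when the function sending $i\in I$ to $(j_0,\dots,j_{m-1})$, where $R_i$ has type $\prod_{k<m}X_{j_k}$, is computable; for each computable language a computable encoding of its first-order formulas is fixed. A computable $\mathcal{L}$-structure $\mathcal{N}$ has a computable underlying set, and $\{(a,j) : a\in (X_j)^{\mathcal{N}}\}$ and $\{(\overline{b},i) : \overline{b}\in (R_i)^{\mathcal{N}}\}$ are computable. Writing $\{e\}$ for the $e$th Turing machine, $c\in\mathbb{N}$ is a code for a structure if $\{c\}(0)$ is a code for a computable language, denoted $\mathcal{L}_c$, and $\{c\}(1)$ is a code for a computable $\mathcal{L}_c$-structure,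 denoted $\mathcal{M}_c$. $\mathrm{CompStr}$ is the set of all codes for structures. Formulas $\varphi(\overline{x};\overline{y})$ come with a specified partition of their free variables. A ''set of formulas'' is a set of formulas with specified variable partitions. $\mathrm{ACL}^c_n$ is the set of pairs $(\varphi(\overline{x};\overline{y}),\overline{a})$ such that $\varphi$ is a first-order $\mathcal{L}_c$-formula that is a Boolean combination of $\Sigma_n$-formulas, $\overline{a}\in\mathcal{M}_c$ has the same type as $\overline{x}$, and $\{\overline{b}\in\mathcal{M}_c : \mathcal{M}_c\models\varphi(\overline{a};\overline{b})\}$ is finite (possibly empty). $\mathrm{DCL}^c_n$ is defined in the same way, with ''finite'' replaced by ''a singleton''. Closure operators. For a set $\Phi$ of first-order $\mathcal{L}$-formulas, an $\mathcal{L}$-structure $\mathcal{N}$, $B\subseteq\mathcal{N}$ and $S\subseteq\mathbb{N}\cup\{\infty\}$: $\mathrm{cl}^0_{\Phi,\mathcal{N}}(B,S):=B$; $\mathrm{cl}^1_{\Phi,\mathcal{N}}(B,S)$ is $B$ together with all $b\in\mathcal{N}$ for which there are $\varphi\in\Phi$ and a tuple $\overline{a}$ from $B$ with $|\{\overline{d} : \mathcal{N}\models\varphi(\overline{a};\overline{d})\}|\in S$ and a tuple $\overline{b}\in\mathcal{N}$ having $b$ as an entry with $\mathcal{N}\models\varphi(\overline{a};\overline{b})$; $\mathrm{cl}^{m+1}_{\Phi,\mathcal{N}}(B,S):=\mathrm{cl}^1_{\Phi,\mathcal{N}}(\mathrm{cl}^m_{\Phi,\mathcal{N}}(B,S),S)$;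 and $\mathrm{cl}_{\Phi,\mathcal{N}}(B,S):=\bigcup_m \mathrm{cl}^m_{\Phi,\mathcal{N}}(B,S)$. Put $\mathrm{acl}_{\Phi,\mathcal{N}}(B):=\mathrm{cl}_{\Phi,\mathcal{N}}(B,\mathbb{N})$ and $\mathrm{dcl}_{\Phi,\mathcal{N}}(B):=\mathrm{cl}_{\Phi,\mathcal{N}}(B,\{1\})$. As sets, $\mathrm{acl}_{\Phi,\mathcal{N}}:=\{(a,A) : A\subseteq\mathcal{N}\text{ finite},\ a\in\mathrm{acl}_{\Phi,\mathcal{N}}(A)\}$ and $\mathrm{dcl}_{\Phi,\mathcal{N}}:=\{(a,A) : A\subseteq\mathcal{N}\text{ finite},\ a\in\mathrm{dcl}_{\Phi,\mathcal{N}}(A)\}$; write $\mathrm{acl}_{\Phi,c}$, $\mathrm{dcl}_{\Phi,c}$ when $\mathcal{N}=\mathcal{M}_c$. ''Uniformly in'' a parameter means that an arithmetical description (index) of the set at the stated level is obtained computably from the parameter (from $c$, and from an encoding of the computable set $\Phi$ in (c), (d)). *)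

(* Defs.v *)
From Stdlib Require Import Arith Cantor Finite_sets List.
Import ListNotations.

(** * Partial computable functions *)

Definition pr (a b : nat) : nat := Cantor.to_nat (a, b).

(** [computes e x y] is {e}(x) = y.  The numbering [e |-> {e}] is the Goedel
    numbering of Kleene's partial recursive functions, presented as unary
    functions on (codes of) tuples; it is an acceptable numbering of the
    partial computable functions, as is the one by Turing machines. *)
Inductive prog : Type :=
| PZero | PSucc | PFst | PSnd
| PPair (f g : prog)
| PComp (f g : prog)
| PRec (f g : prog)
| PMu (f : prog).

Inductive runs : prog -> nat -> nat -> Prop :=
| runs_zero x : runs PZero x 0
| runs_succ x : runs PSucc x (S x)
| runs_fst a b : runs PFst (pr a b) a
| runs_snd a b : runs PSnd (pr a b) b
| runs_pair f g x y z :
    runs f x y -> runs g x z -> runs (PPair f g) x (pr y z)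
| runs_comp f g x y z :
    runs g x y -> runs f y z -> runs (PComp f g) x z
| runs_rec0 f g a y :
    runs f a y -> runs (PRec f g) (pr a 0) y
| runs_recS f g a k r y :
    runs (PRec f g) (pr a k) r -> runs g (pr a (pr k r)) y ->
    runs (PRec f g) (pr a (S k)) y
| runs_mu f a k :
    runs f (pr a k) 0 ->
    (forall i, i < k -> exists y, runs f (pr a i) (S y)) ->
    runs (PMu f) a k.

Fixpoint code_prog (P : prog) : nat :=
  match P with
  | PZero => pr 0 0
  | PSucc => pr 1 0
  | PFst => pr 2 0
  | PSnd => pr 3 0
  | PPair f g => pr 4 (pr (code_prog f) (code_prog g))
  | PComp f g => pr 5 (pr (code_prog f) (code_prog g))
  | PRec f g => pr 6 (pr (code_prog f) (code_prog g))
  | PMu f => pr 7 (code_prog f)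
  end.

(** Numbers that are not of the form [code_prog P] index the empty function. *)
Definition computes (e x y : nat) : Prop :=
  exists P, code_prog P = e /\ runs P x y.

(** [e] is an index of the (total) characteristic function of [A]. *)
Definition decides (e : nat) (A : nat -> Prop) : Prop :=
  forall x, (A x /\ computes e x 1) \/ (~ A x /\ computes e x 0).

(** * The arithmetical hierarchy *)

(** [exists_first k R x] is [exists y1, forall y2, ...] ([k] alternating
    quantifiers) applied to R(<...<<x, y1>, y2>, ..., yk>). *)
Fixpoint exists_first (k : nat) (R : nat -> Prop) (x : nat) : Prop :=
  match k with
  | 0 => R x
  | S k' => exists y, forall_first k' R (pr x y)
  end
with forall_first (k : nat) (R : nat -> Prop) (x : nat) : Prop :=
  match k with
  | 0 => R x
  | S k' => forall y, exists_first k' R (pr x y)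
  end.

Definition Sigma_index (k e : nat) (A : nat -> Prop) : Prop :=
  exists R, decides e R /\ forall x, A x <-> exists_first k R x.

Definition Pi_index (k e : nat) (A : nat -> Prop) : Prop :=
  exists R, decides e R /\ forall x, A x <-> forall_first k R x.

Definition Delta_index (k e : nat) (A : nat -> Prop) : Prop :=
  exists e1 e2, e = pr e1 e2 /\ Sigma_index k e1 A /\ Pi_index k e2 A.

(** * Languages, formulas and structures *)

(** [None] stands for the whole of N and [Some k] for {0, ..., k-1}. *)
Definition below (o : option nat) (i : nat) : Prop :=
  match o with None => True | Some k => i < k end.

(** The values of [ty] outside [below rels] are irrelevant. *)
Record language : Type := {
  sorts : option nat;
  rels : option nat;
  ty : nat -> list nat;
  ty_sorts : forall i, below rels i -> Forall (below sorts) (ty i)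
}.

(** (j, k) is the [k]th variable of sort X_j. *)
Definition var : Type := nat * nat.
Definition var_sort (v : var) : nat := fst v.

Inductive form : Type :=
| Fal
| Rel (i : nat) (vs : list var)
| Eq (v w : var)
| Neg (f : form)
| And (f g : form)
| Or (f g : form)
| Ex (v : var) (f : form)
| All (v : var) (f : form).

Fixpoint wf (L : language) (f : form) : Prop :=
  match f with
  | Fal => True
  | Rel i vs => below (rels L) i /\ map var_sort vs = ty L i
  | Eq v w => below (sorts L) (var_sort v) /\ var_sort v = var_sort w
  | Neg f => wf L f
  | And f g | Or f g => wf L f /\ wf L g
  | Ex v f | All v f => below (sorts L) (var_sort v) /\ wf L f
  end.

Fixpoint free (x : var) (f : form) : Prop :=
  match f with
  | Fal => False
  | Rel _ vs => In x vs
  | Eq v w => x = v \/ x = w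
  | Neg f => free x f
  | And f g | Or f g => free x f \/ free x g
  | Ex v f | All v f => x <> v /\ free x f
  end.

Fixpoint quantifier_rank (f : form) : nat :=
  match f with
  | Fal | Rel _ _ | Eq _ _ => 0
  | Neg f => quantifier_rank f
  | And f g | Or f g => Nat.max (quantifier_rank f) (quantifier_rank g)
  | Ex _ f | All _ f => S (quantifier_rank f)
  end.

Fixpoint quantifier_free (f : form) : Prop :=
  match f with
  | Fal | Rel _ _ | Eq _ _ => True
  | Neg f => quantifier_free f
  | And f g | Or f g => quantifier_free f /\ quantifier_free g
  | Ex _ _ | All _ _ => False
  end.

(** Prenex formulas with [n] alternating, possibly empty, quantifier blocks. *)
Inductive Sigma_form : nat -> form -> Prop :=
| Sigma_qf f : quantifier_free f -> Sigma_form 0 f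
| Sigma_Pi n f : Pi_form n f -> Sigma_form (S n) f
| Sigma_Ex n v f : Sigma_form (S n) f -> Sigma_form (S n) (Ex v f)
with Pi_form : nat -> form -> Prop :=
| Pi_qf f : quantifier_free f -> Pi_form 0 f
| Pi_Sigma n f : Sigma_form n f -> Pi_form (S n) f
| Pi_All n v f : Pi_form (S n) f -> Pi_form (S n) (All v f).

Inductive bool_comb (P : form -> Prop) : form -> Prop :=
| bc_base f : P f -> bool_comb P f
| bc_neg f : bool_comb P f -> bool_comb P (Neg f)
| bc_and f g : bool_comb P f -> bool_comb P g -> bool_comb P (And f g)
| bc_or f g : bool_comb P f -> bool_comb P g -> bool_comb P (Or f g).

(** A formula f(x; y) with a partition of its free variables. *)
Record pform : Type := { body : form; pxs : list var; pys : list var }.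

Definition pwf (L : language) (p : pform) : Prop :=
  wf L (body p) /\ NoDup (pxs p ++ pys p) /\
  forall v, free v (body p) <-> In v (pxs p ++ pys p).

Record structure (L : language) : Type := {
  dom : nat -> Prop;
  sort : nat -> nat -> Prop;
  rel : nat -> list nat -> Prop;
  sort_dom : forall j a, sort j a -> below (sorts L) j /\ dom a;
  dom_sort : forall a, dom a -> exists! j, sort j a;
  rel_ty : forall i bs, rel i bs -> below (rels L) i /\ Forall2 sort (ty L i) bs
}.
Arguments dom {L}.
Arguments sort {L}.
Arguments rel {L}.

Definition has_type {L} (M : structure L) (js bs : list nat) : Prop :=
  Forall2 (sort M) js bs.

Definition var_eqb (v w : var) : bool :=
  (fst v =? fst w) && (snd v =? snd w).

Definition update (r : var -> nat) (v : var) (a : nat) : var -> nat :=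
  fun w => if var_eqb w v then a else r w.

Fixpoint sat {L} (M : structure L) (r : var -> nat) (f : form) : Prop :=
  match f with
  | Fal => False
  | Rel i vs => rel M i (map r vs)
  | Eq v w => r v = r w
  | Neg f => ~ sat M r f
  | And f g => sat M r f /\ sat M r g
  | Or f g => sat M r f \/ sat M r g
  | Ex v f => exists a, sort M (var_sort v) a /\ sat M (update r v a) f
  | All v f => forall a, sort M (var_sort v) a -> sat M (update r v a) f
  end.

(** The assignment sending the variables [vs] to [bs]; the value 0 elsewhere
    is a dummy. *)
Fixpoint assign (vs : list var) (bs : list nat) : var -> nat :=
  match vs, bs with
  | v :: vs', b :: bs' => update (assign vs' bs') v b
  | _, _ => fun _ => 0
  end.

(** M |= p(xs; ys), the tuples being of the right types. *)
Definition holds {L} (M : structure L) (p : pform) (xs ys : list nat) : Prop :=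
  has_type M (map var_sort (pxs p)) xs /\
  has_type M (map var_sort (pys p)) ys /\
  sat M (assign (pxs p ++ pys p) (xs ++ ys)) (body p).

(** * Codes *)

Fixpoint code_list (l : list nat) : nat :=
  match l with
  | [] => 0
  | a :: l' => S (pr a (code_list l'))
  end.

Definition code_var (v : var) : nat := pr (fst v) (snd v).
Definition code_vars (vs : list var) : nat := code_list (map code_var vs).

Fixpoint code_form (f : form) : nat :=
  match f with
  | Fal => pr 0 0
  | Rel i vs => pr 1 (pr i (code_vars vs))
  | Eq v w => pr 2 (pr (code_var v) (code_var w))
  | Neg f => pr 3 (code_form f)
  | And f g => pr 4 (pr (code_form f) (code_form g))
  | Or f g => pr 5 (pr (code_form f) (code_form g))
  | Ex v f => pr 6 (pr (code_var v) (code_form f))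
  | All v f => pr 7 (pr (code_var v) (code_form f))
  end.

Definition code_pform (p : pform) : nat :=
  pr (code_form (body p)) (pr (code_vars (pxs p)) (code_vars (pys p))).

(** The set of codes of the elements of [A]. *)
Definition coded {T : Type} (code : T -> nat) (A : T -> Prop) : nat -> Prop :=
  fun x => exists t, A t /\ x = code t.

Definition code_bound (o : option nat) : nat :=
  match o with None => 0 | Some k => S k end.

Definition codes_language (l : nat) (L : language) : Prop :=
  exists e,
    l = pr (code_bound (sorts L)) (pr (code_bound (rels L)) e) /\
    forall i, below (rels L) i -> computes e i (code_list (ty L i)).

Definition codes_structure (s : nat) {L} (M : structure L) : Prop :=
  exists ed es er,
    s = pr ed (pr es er) /\
    decides ed (dom M) /\
    decides es (coded (fun t => pr (fst t) (snd t))
                      (fun t : nat * nat => sort M (snd t) (fst t))) /\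
    decides er (coded (fun t => pr (code_list (fst t)) (snd t))
                      (fun t : list nat * nat => rel M (snd t) (fst t))).

(** [c] is in CompStr, with L_c = [L] and M_c = [M]. *)
Definition codes (c : nat) {L} (M : structure L) : Prop :=
  exists l s, computes c 0 l /\ codes_language l L /\
              computes c 1 s /\ codes_structure s M.

(** * Algebraic and definable closure *)

Definition ACL (n : nat) {L} (M : structure L) : pform * list nat -> Prop :=
  fun '(p, xs) =>
    pwf L p /\ bool_comb (Sigma_form n) (body p) /\
    has_type M (map var_sort (pxs p)) xs /\
    Finite (list nat) (holds M p xs).

Definition DCL (n : nat) {L} (M : structure L) : pform * list nat -> Prop :=
  fun '(p, xs) =>
    pwf L p /\ bool_comb (Sigma_form n) (body p) /\
    has_type M (map var_sort (pxs p)) xs /\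
    exists! ys, holds M p xs ys.

Definition code_instance (t : pform * list nat) : nat :=
  pr (code_pform (fst t)) (code_list (snd t)).

(** |X| belongs to S, a subset of N + {infinity}, where [None] is infinity. *)
Definition card_in {T : Type} (X : T -> Prop) (S : option nat -> Prop) : Prop :=
  (exists k, cardinal T X k /\ S (Some k)) \/ (~ Finite T X /\ S None).

Section Closure.
Context {L : language} (Phi : pform -> Prop) (M : structure L).

Definition cl1 (B : nat -> Prop) (S : option nat -> Prop) : nat -> Prop :=
  fun b =>
    B b \/
    exists p xs ys,
      Phi p /\ has_type M (map var_sort (pxs p)) xs /\ Forall B xs /\
      card_in (holds M p xs) S /\ In b ys /\ holds M p xs ys.

Fixpoint cl_iter (m : nat) (B : nat -> Prop) (S : option nat -> Prop) :
    nat -> Prop :=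
  match m with
  | 0 => B
  | Datatypes.S m' => cl1 (cl_iter m' B S) S
  end.

Definition cl (B : nat -> Prop) (S : option nat -> Prop) : nat -> Prop :=
  fun b => exists m, cl_iter m B S b.

Definition acl (B : nat -> Prop) : nat -> Prop :=
  cl B (fun k => k <> None).

Definition dcl (B : nat -> Prop) : nat -> Prop :=
  cl B (fun k => k = Some 1).

(** [canonical u] is the finite set with canonical index [u], that is,
    u = sum of 2^x over its elements x; every finite set of natural numbers has
    exactly one canonical index. *)
Definition canonical (u : nat) : nat -> Prop :=
  fun x => Nat.testbit u x = true.

(** The sets of pairs (a, A), the finite set A being given by its canonical
    index. *)
Definition acl_pairs : nat * nat -> Prop :=
  fun '(a, u) => (forall x, canonical u x -> dom M x) /\ acl (canonical u) a.

Definition dcl_pairs : nat * nat -> Prop :=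
  fun '(a, u) => (forall x, canonical u x -> dom M x) /\ dcl (canonical u) a.

End Closure.

(** [q] encodes the computable set [Phi] of L-formulas of quantifier rank at
    most [n]. *)
Definition codes_formulas (n q : nat) (L : language) (Phi : pform -> Prop) :
    Prop :=
  decides q (coded code_pform Phi) /\
  forall p, Phi p -> pwf L p /\ quantifier_rank (body p) <= n.

(* Main.v *)
From Stdlib Require Import Cantor Arith Bool Ensembles Finite_sets List Lia.
From Stdlib Require Import Classical ClassicalEpsilon.
From Stdlib Require Import FunctionalExtensionality PropExtensionality.
Require Import Defs.
Import ListNotations.

(** Let the rank of a formula be the number of its alternations of quantifier
    blocks, where Boolean connectives are free ([rank]).  It is at most n on
    Boolean combinations of Sigma_n formulas and on formulas of quantifier rank
    at most n, so these two classes can be treated together.  The main point is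
    that satisfaction of formulas of rank at most n in a computable structure is
    Delta_(n+1), uniformly in a code for the structure, in the formula and in the
    assignment ([arith_sat], [arith_holds]).  This goes by induction on n.  An
    existential block is witnessed by a tuple, and dually for a universal block;
    a Boolean combination of blocks is evaluated by guessing a finite list of
    claims about the truth values of blocks that forces the value of the
    combination, and asking that all claims in the list are correct.  The last
    condition is a bounded universal quantifier, which does not increase the
    complexity of a Sigma predicate since the witnesses can be collected in a
    list ([arith_Forall]).

    The rest is counting quantifiers.  Finiteness of the solution set of f(a; y)
    says that there is a list such that every solution is in it, that is, an
    existential quantifier, a universal quantifier and a Delta_(n+1) predicate:
    Sigma_(n+2) ([arith_finite]).  Having exactly one solution is the conjunction
    of a Sigma_(n+1) and a Pi_(n+1) statement, hence Delta_(n+2)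
    ([arith_unique]).  The syntactic conditions on formulas are decidable, except
    that the condition on the free variables is Pi_1 as it is stated, which is
    within the bounds because n + 2 is at least 2.  Finally, an element belongs to
    a closure if there is a derivation of it, a finite list of elements each
    obtained from earlier ones by a formula in the given set with finitely many
    solutions (or just one); correctness of a derivation is again Sigma_(n+2) by
    the closure under bounded quantification ([cl_derivation], [arith_cl]).

    Uniformity is dealt with by computing on coded types, one of which is the
    type of structures given with a code ([instance]).  A predicate on such
    inputs is decidable if one program decides it for all of them, and it is
    Sigma_k or Pi_k ([arith]) if it is obtained by k quantifiers from a decidable
    predicate.  The s-m-n theorem then turns the input that is a code into an
    index ([arith_index]).  Using the indices contained in the code of a structure
    requires a universal program ([universal_program]); Kleene's recursion
    theorem ([comp_fix]) gives the recursions on lists and on formulas. *)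


(** * Pairing *)

Definition p1 (n : nat) : nat := fst (Cantor.of_nat n).
Definition p2 (n : nat) : nat := snd (Cantor.of_nat n).

Lemma p1_pr a b : p1 (pr a b) = a.
Proof. unfold p1, pr. now rewrite Cantor.cancel_of_to. Qed.

Lemma p2_pr a b : p2 (pr a b) = b.
Proof. unfold p2, pr. now rewrite Cantor.cancel_of_to. Qed.

Lemma pr_eta n : pr (p1 n) (p2 n) = n.
Proof.
  unfold p1, p2, pr. rewrite <- surjective_pairing. apply Cantor.cancel_to_of.
Qed.

Lemma pr_inj a b c d : pr a b = pr c d -> a = c /\ b = d.
Proof.
  intros E. split; [rewrite <- (p1_pr a b), E, p1_pr | rewrite <- (p2_pr a b), E, p2_pr];
    reflexivity.
Qed.

Lemma pr_ge a b : a + b <= pr a b.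
Proof. pose proof (Cantor.to_nat_non_decreasing a b). unfold pr. lia. Qed.

Global Opaque pr p1 p2.

(** * Computability of functions between coded types *)

Class Enc (A : Type) : Type := code : A -> nat.

#[export] Instance enc_nat : Enc nat := fun n => n.
#[export] Instance enc_bool : Enc bool := Nat.b2n.
#[export] Instance enc_prod {A B} `{Enc A} `{Enc B} : Enc (A * B) :=
  fun p => pr (code (fst p)) (code (snd p)).

Definition total {A : Type} : A -> Prop := fun _ => True.

(** The domain [D] is that of a partial function: hypotheses on the input, such
    as that one of its entries is an index with a given property, are put
    there.  Since only the codes of inputs matter, a type of inputs may also
    carry data that no program can inspect, like a structure with its code. *)
Definition comp {A B} `{Enc A} `{Enc B} (D : A -> Prop) (F : A -> B) : Prop :=
  exists P, forall a, D a -> runs P (code a) (code (F a)).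

Definition PId : prog := PPair PFst PSnd.

Fixpoint PConst (n : nat) : prog :=
  match n with 0 => PZero | S n => PComp PSucc (PConst n) end.

Lemma runs_id x : runs PId x x.
Proof. rewrite <- (pr_eta x). repeat constructor. Qed.

Lemma runs_const n x : runs (PConst n) x n.
Proof.
  induction n; simpl; [constructor | econstructor; [eassumption | constructor]].
Qed.

Section Basic.
Context {A B C : Type} `{Enc A} `{Enc B} `{Enc C} (D : A -> Prop).

Lemma comp_code (F : A -> B) (G : A -> C) :
  (forall a, D a -> code (G a) = code (F a)) -> comp D F -> comp D G.
Proof.
  intros E [P HP]. exists P. intros a Ha. rewrite E by assumption. auto.
Qed.

Lemma comp_ext (F G : A -> B) :
  (forall a, D a -> G a = F a) -> comp D F -> comp D G.
Proof.
  intros E [P HP]. exists P. intros a Ha. rewrite E by assumption. auto.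
Qed.

Lemma comp_weaken (D' : A -> Prop) (F : A -> B) :
  (forall a, D a -> D' a) -> comp D' F -> comp D F.
Proof. intros E [P HP]. exists P. auto. Qed.

Lemma comp_id : comp D (fun x => x).
Proof. exists PId. intros. apply runs_id. Qed.

Lemma comp_const (b : B) : comp D (fun _ => b).
Proof. exists (PConst (code b)). intros. apply runs_const. Qed.

Lemma comp_fst (f : A -> B * C) : comp D f -> comp D (fun x => fst (f x)).
Proof.
  intros [P HP]. exists (PComp PFst P). intros a Ha. econstructor.
  - apply HP, Ha.
  - constructor.
Qed.

Lemma comp_snd (f : A -> B * C) : comp D f -> comp D (fun x => snd (f x)).
Proof.
  intros [P HP]. exists (PComp PSnd P). intros a Ha. econstructor.
  - apply HP, Ha.
  - constructor.
Qed.

Lemma comp_pair (f : A -> B) (g : A -> C) :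
  comp D f -> comp D g -> comp D (fun x => (f x, g x)).
Proof.
  intros [P HP] [Q HQ]. exists (PPair P Q). intros a Ha.
  constructor; auto.
Qed.

Lemma comp_compose (E : B -> Prop) (g : B -> C) (f : A -> B) :
  comp E g -> comp D f -> (forall a, D a -> E (f a)) ->
  comp D (fun x => g (f x)).
Proof.
  intros [P HP] [Q HQ] HE. exists (PComp P Q). intros a Ha.
  econstructor; eauto.
Qed.

Lemma comp_app (g : B -> C) (f : A -> B) :
  comp total g -> comp D f -> comp D (fun x => g (f x)).
Proof. intros Hg Hf. apply (comp_compose total); auto. intros; exact I. Qed.

End Basic.

Lemma comp_app2 {A B C E} `{Enc A} `{Enc B} `{Enc C} `{Enc E} (D : A -> Prop)
  (g : B -> C -> E) (f1 : A -> B) (f2 : A -> C) :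
  comp total (fun p => g (fst p) (snd p)) -> comp D f1 -> comp D f2 ->
  comp D (fun x => g (f1 x) (f2 x)).
Proof.
  intros Hg Hf1 Hf2.
  apply (comp_app D (fun p => g (fst p) (snd p)) (fun x => (f1 x, f2 x)) Hg).
  now apply comp_pair.
Qed.

Lemma comp_natrec {A B} `{Enc A} `{Enc B}
  (z : A -> B) (g : A * (nat * B) -> B) :
  comp total z -> comp total g ->
  comp total (fun x => nat_rect (fun _ => B) (z (fst x))
                       (fun k r => g (fst x, (k, r))) (snd x)).
Proof.
  intros [P HP] [Q HQ]. exists (PRec P Q). intros [a k] _. simpl.
  unfold code at 1, enc_prod. simpl. induction k; simpl.
  - constructor. apply HP. exact I.
  - econstructor; [exact IHk |]. apply (HQ (a, (k, _))). exact I.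
Qed.

(** Extended by [Ltac comp_more ::=] after each group of closure lemmas. *)
Ltac comp_more := fail.
Ltac comp1 :=
  first [ assumption | simple apply comp_id | simple apply comp_const
        | simple eapply comp_pair | simple eapply comp_fst | simple eapply comp_snd
        | comp_more ].
Ltac comp := repeat comp1.

Lemma comp_S {A} `{Enc A} (D : A -> Prop) (f : A -> nat) :
  comp D f -> comp D (fun x => S (f x)).
Proof.
  apply (comp_app D S). exists PSucc. intros; constructor.
Qed.

Lemma comp_pred {A} `{Enc A} (D : A -> Prop) (f : A -> nat) :
  comp D f -> comp D (fun x => pred (f x)).
Proof.
  apply (comp_app D pred).
  apply (comp_ext _ (fun x : nat => nat_rect (fun _ => nat) 0 (fun k _ => k) x)).
  { now intros []. }
  pose proof (comp_natrec (fun _ : nat => 0) (fun x => fst (snd x))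
    ltac:(comp) ltac:(comp)) as R.
  apply (comp_app _ _ (fun x : nat => (x, x)) R). comp.
Qed.

Lemma comp_add {A} `{Enc A} (D : A -> Prop) (f g : A -> nat) :
  comp D f -> comp D g -> comp D (fun x => f x + g x).
Proof.
  apply (comp_app2 D Nat.add).
  apply (comp_ext _ (fun x : nat * nat =>
    nat_rect (fun _ => nat) (fst x) (fun _ r => S r) (snd x))).
  - intros [a b] _. simpl. induction b; simpl; lia.
  - apply (comp_natrec (fun a => a) (fun x => S (snd (snd x)))).
    + comp.
    + apply comp_S. comp.
Qed.

Lemma comp_sub {A} `{Enc A} (D : A -> Prop) (f g : A -> nat) :
  comp D f -> comp D g -> comp D (fun x => f x - g x).
Proof.
  apply (comp_app2 D Nat.sub).
  apply (comp_ext _ (fun x : nat * nat =>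
    nat_rect (fun _ => nat) (fst x) (fun _ r => pred r) (snd x))).
  - intros [a b] _. simpl. induction b; simpl; lia.
  - apply (comp_natrec (fun a => a) (fun x => pred (snd (snd x)))).
    + comp.
    + apply comp_pred. comp.
Qed.

Ltac comp_nat :=
  first [ simple apply comp_S | simple apply comp_pred | simple apply comp_add
        | simple apply comp_sub ].
Ltac comp_more ::= comp_nat.

(** Only the branch selected by [b] is evaluated, so each branch need only be
    computable where it is selected.  A recursion of length 0 or 1 that starts
    from 0 runs its step lazily; exactly one of the two recursions that are
    added has length 1. *)
Lemma comp_if {A B} `{Enc A} `{Enc B} (D : A -> Prop)
  (b : A -> bool) (F G : A -> B) :
  comp D b ->
  comp (fun a => D a /\ b a = true) F ->
  comp (fun a => D a /\ b a = false) G ->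
  comp D (fun a => if b a then F a else G a).
Proof.
  intros Hb [P HP] [Q HQ].
  assert (L : forall (c : A -> bool) (R : prog) (V : A -> B), comp D c ->
    (forall a, D a -> c a = true -> runs R (code a) (code (V a))) ->
    comp D (fun a => if c a then code (V a) else 0)).
  { intros c R V [Pc HPc] HR.
    exists (PComp (PRec PZero (PComp R PFst)) (PPair PId Pc)). intros a Ha.
    econstructor.
    - constructor; [apply runs_id | apply HPc, Ha].
    - specialize (HR a Ha). destruct (c a); simpl.
      + eapply runs_recS; [constructor; constructor |].
        econstructor; [constructor |]. now apply HR.
      + constructor. constructor. }
  assert (Hn : comp D (fun a => negb (b a))).
  { apply (comp_code _ (fun a => 1 - Nat.b2n (b a))).
    - intros a _. unfold code, enc_bool, enc_nat. now destruct (b a).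
    - apply comp_sub; [comp |]. apply (comp_code _ b); [| exact Hb]. reflexivity. }
  apply (comp_code _ (fun a => (if b a then code (F a) else 0)
                             + (if negb (b a) then code (G a) else 0))).
  - intros a _. unfold code at 2, enc_nat. destruct (b a); simpl; lia.
  - apply comp_add; [apply (L b P F Hb) | apply (L (fun a => negb (b a)) Q G Hn)].
    + intros a H1 H2. apply HP. auto.
    + intros a H1 H2. apply HQ. split; [assumption |]. now destruct (b a).
Qed.

Lemma comp_ite {A B} `{Enc A} `{Enc B} (D : A -> Prop)
  (b : A -> bool) (F G : A -> B) :
  comp D b -> comp D F -> comp D G ->
  comp D (fun a => if b a then F a else G a).
Proof.
  intros Hb HF HG. apply comp_if; [assumption | |];
    (eapply comp_weaken; [| eassumption]); tauto.
Qed.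
Ltac comp_more ::= first [ simple apply comp_ite | comp_nat ].

Section Bool.
Context {A : Type} `{Enc A} (D : A -> Prop).

Lemma comp_negb (f : A -> bool) : comp D f -> comp D (fun x => negb (f x)).
Proof. intros. unfold negb. comp. Qed.

Lemma comp_andb (f g : A -> bool) :
  comp D f -> comp D g -> comp D (fun x => f x && g x).
Proof. intros. unfold andb. comp. Qed.

Lemma comp_orb (f g : A -> bool) :
  comp D f -> comp D g -> comp D (fun x => f x || g x).
Proof. intros. unfold orb. comp. Qed.

Lemma comp_leb (f g : A -> nat) :
  comp D f -> comp D g -> comp D (fun x => f x <=? g x).
Proof.
  intros Hf Hg.
  apply (comp_code _ (fun x => 1 - (f x - g x))); [| comp].
  intros a _. unfold code, enc_nat, enc_bool.
  destruct (Nat.leb_spec (f a) (g a)); simpl Nat.b2n; lia.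
Qed.

Lemma comp_eqb (f g : A -> nat) :
  comp D f -> comp D g -> comp D (fun x => f x =? g x).
Proof.
  intros Hf Hg.
  apply (comp_ext _ (fun x => (f x <=? g x) && (g x <=? f x))).
  - intros a _. destruct (Nat.leb_spec (f a) (g a)), (Nat.leb_spec (g a) (f a)),
      (Nat.eqb_spec (f a) (g a)); simpl; lia.
  - apply comp_andb; now apply comp_leb.
Qed.

Lemma comp_pr (f g : A -> nat) :
  comp D f -> comp D g -> comp D (fun x => pr (f x) (g x)).
Proof.
  intros Hf Hg. apply (comp_code _ (fun x => (f x, g x))); [| comp]. reflexivity.
Qed.

Lemma comp_p1 (f : A -> nat) : comp D f -> comp D (fun x => p1 (f x)).
Proof.
  intros Hf. apply (comp_code _ (fun x => fst (p1 (f x), p2 (f x)))); [reflexivity |].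
  apply comp_fst. apply (comp_code _ f); [| assumption].
  intros a _. apply pr_eta.
Qed.

Lemma comp_p2 (f : A -> nat) : comp D f -> comp D (fun x => p2 (f x)).
Proof.
  intros Hf. apply (comp_code _ (fun x => snd (p1 (f x), p2 (f x)))); [reflexivity |].
  apply comp_snd. apply (comp_code _ f); [| assumption].
  intros a _. apply pr_eta.
Qed.

End Bool.

Ltac comp_bool :=
  first [ simple apply comp_p1 | simple apply comp_p2 | simple apply comp_pr
        | simple apply comp_negb | simple apply comp_andb | simple apply comp_orb
        | simple apply comp_leb | simple apply comp_eqb
        | simple apply comp_ite | comp_nat ].
Ltac comp_more ::= comp_bool.

(** * A universal program and the recursion theorem *)

(** A configuration [(m, (e, (v, K)))] of the abstract machine either evaluates
    the program coded by [e] at [v] (if [m] is 0) or returns the value [v] (if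
    [m] is 1) to the stack [K] of pending computations.  The tag of a stack
    frame tells which premise of which rule of [runs] is being awaited. *)
Local Notation config := (nat * (nat * (nat * nat)))%type.

Definition eval_at (e v K : nat) : config := (0, (e, (v, K))).
Definition return_to (v K : nat) : config := (1, (0, (v, K))).
Definition push (tag fr K : nat) : nat := S (pr (pr tag fr) K).

Definition step (s : config) : config :=
  let m := fst s in
  let e := fst (snd s) in
  let v := fst (snd (snd s)) in
  let K := snd (snd (snd s)) in
  let b := p2 e in
  if m =? 0 then
    if p1 e =? 0 then return_to 0 K
    else if p1 e =? 1 then return_to (S v) K
    else if p1 e =? 2 then return_to (p1 v) K
    else if p1 e =? 3 then return_to (p2 v) K
    else if p1 e =? 4 then eval_at (p1 b) v (push 0 (pr (p2 b) v) K)
    else if p1 e =? 5 then eval_at (p2 b) v (push 2 (p1 b) K)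
    else if p1 e =? 6 then
      if p2 v =? 0 then eval_at (p1 b) (p1 v) K
      else eval_at e (pr (p1 v) (pred (p2 v)))
             (push 3 (pr (p2 b) (pr (p1 v) (pred (p2 v)))) K)
    else eval_at b (pr v 0) (push 4 (pr b (pr v 0)) K)
  else if K =? 0 then s
  else
    let t := p1 (p1 (pred K)) in
    let fr := p2 (p1 (pred K)) in
    let K' := p2 (pred K) in
    if t =? 0 then eval_at (p1 fr) (p2 fr) (push 1 v K')
    else if t =? 1 then return_to (pr fr v) K'
    else if t =? 2 then eval_at fr v K'
    else if t =? 3 then
      eval_at (p1 fr) (pr (p1 (p2 fr)) (pr (p2 (p2 fr)) v)) K'
    else if v =? 0 then return_to (p2 (p2 fr)) K'
    else eval_at (p1 fr) (pr (p1 (p2 fr)) (S (p2 (p2 fr))))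
           (push 4 (pr (p1 fr) (pr (p1 (p2 fr)) (S (p2 (p2 fr))))) K').

Lemma comp_step : comp total step.
Proof. unfold step, eval_at, return_to, push. cbv zeta. comp. Qed.

Definition reaches (s s' : config) : Prop := exists n, Nat.iter n step s = s'.

Lemma reaches_refl s : reaches s s.
Proof. now exists 0. Qed.

Lemma reaches_trans s1 s2 s3 : reaches s1 s2 -> reaches s2 s3 -> reaches s1 s3.
Proof.
  intros [m Hm] [k Hk]. exists (k + m). rewrite Nat.iter_add. congruence.
Qed.

Lemma reaches_step s s' : reaches (step s) s' -> reaches s s'.
Proof. apply reaches_trans. now exists 1. Qed.

(** The induction principle generated for [runs] gives no hypothesis for the
    premises of [runs_mu] that say that smaller arguments are rejected. *)
Lemma runs_nested_ind (Q : prog -> nat -> nat -> Prop) :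
  (forall x, Q PZero x 0) -> (forall x, Q PSucc x (S x)) ->
  (forall a b, Q PFst (pr a b) a) -> (forall a b, Q PSnd (pr a b) b) ->
  (forall f g x y z, Q f x y -> Q g x z -> Q (PPair f g) x (pr y z)) ->
  (forall f g x y z, Q g x y -> Q f y z -> Q (PComp f g) x z) ->
  (forall f g a y, Q f a y -> Q (PRec f g) (pr a 0) y) ->
  (forall f g a k r y, Q (PRec f g) (pr a k) r -> Q g (pr a (pr k r)) y ->
     Q (PRec f g) (pr a (S k)) y) ->
  (forall f a k, Q f (pr a k) 0 ->
     (forall i, i < k -> exists y, Q f (pr a i) (S y)) -> Q (PMu f) a k) ->
  forall P x y, runs P x y -> Q P x y.
Proof.
  intros H0 H1 H2 H3 H4 H5 H6 H7 H8.
  fix IH 4. intros P x y R.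
  destruct R as [x | x | a b | a b | f g x y z R1 R2 | f g x y z R1 R2
                | f g a y R1 | f g a k r y R1 R2 | f a k R1 R2].
  - apply H0.
  - apply H1.
  - apply H2.
  - apply H3.
  - apply H4; apply IH; assumption.
  - apply H5 with y; apply IH; assumption.
  - apply H6, IH, R1.
  - apply H7 with r; apply IH; assumption.
  - apply H8; [apply IH, R1 |]. intros i Hi.
    destruct (R2 i Hi) as [y Hy]. exists y. apply IH, Hy.
Qed.

(** Performs one machine step from a configuration whose program or topmost
    frame is known. *)
Ltac machine_step :=
  apply reaches_step; unfold step, push;
  repeat (cbn - [pr p1 p2 reaches]; rewrite ?p1_pr, ?p2_pr);
  repeat change (0, (?e, (?v, ?K))) with (eval_at e v K);
  repeat change (1, (0, (?v, ?K))) with (return_to v K);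
  repeat change (S (pr (pr ?t ?fr) ?K)) with (push t fr K).

Lemma runs_reaches P x y :
  runs P x y -> forall K, reaches (eval_at (code_prog P) x K) (return_to y K).
Proof.
  revert P x y.
  apply (runs_nested_ind (fun P x y => forall K,
           reaches (eval_at (code_prog P) x K) (return_to y K))).
  - intros. machine_step. apply reaches_refl.
  - intros. machine_step. apply reaches_refl.
  - intros. machine_step. apply reaches_refl.
  - intros. machine_step. apply reaches_refl.
  - intros f g x y z IHf IHg K. machine_step.
    eapply reaches_trans; [apply IHf |]. machine_step.
    eapply reaches_trans; [apply IHg |]. machine_step. apply reaches_refl.
  - intros f g x y z IHg IHf K. machine_step.
    eapply reaches_trans; [apply IHg |]. machine_step. apply IHf.
  - intros f g a y IHf K. machine_step. apply IHf.
  - intros f g a k r y IHr IHg K. machine_step.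
    eapply reaches_trans; [apply (IHr (push _ _ _)) |]. machine_step. apply IHg.
  - intros f a k Hk Hlt K. machine_step.
    enough (L : forall i, i <= k -> reaches
      (eval_at (code_prog f) (pr a 0) (push 4 (pr (code_prog f) (pr a 0)) K))
      (eval_at (code_prog f) (pr a i) (push 4 (pr (code_prog f) (pr a i)) K))).
    { eapply reaches_trans; [apply (L k (le_n k)) |].
      eapply reaches_trans; [apply Hk |]. machine_step. apply reaches_refl. }
    induction i; intros Hi; [apply reaches_refl |].
    eapply reaches_trans; [apply IHi; lia |].
    destruct (Hlt i Hi) as [y Hy].
    eapply reaches_trans; [apply Hy |]. machine_step. apply reaches_refl.
Qed.

Definition halted (s : config) : bool :=
  (fst s =? 1) && (snd (snd (snd s)) =? 0).

Lemma least_witness (Q : nat -> Prop) n :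
  Q n -> exists k, Q k /\ forall i, i < k -> ~ Q i.
Proof.
  revert n. apply (well_founded_induction_type lt_wf (fun n => Q n -> _)).
  intros n IH Hn. destruct (classic (exists i, i < n /\ Q i)) as [[i [Hi HQ]] | N].
  - exact (IH i Hi HQ).
  - exists n. split; [assumption |]. intros i Hi HQ. apply N. eauto.
Qed.

Lemma halted_step s : halted s = true -> step s = s.
Proof.
  destruct s as [m [e [v K]]]. unfold halted, step; simpl fst; simpl snd.
  destruct (Nat.eqb_spec m 1), (Nat.eqb_spec K 0); try discriminate.
  subst. reflexivity.
Qed.

(** The number of steps until the machine halts is found by minimization; a
    halted configuration is a fixed point of [step], so the least such number
    gives the same value as any other. *)
Lemma universal_program :
  exists U, forall e x y, computes e x y -> runs U (pr e x) y.
Proof.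
  set (conf := fun (p : nat * nat) t => Nat.iter t step (eval_at (fst p) (snd p) 0)).
  assert (Hc : comp total (fun q : nat * nat * nat => conf (fst q) (snd q))).
  { pose proof (comp_natrec (fun p : nat * nat => eval_at (fst p) (snd p) 0)
      (fun x => step (snd (snd x)))) as R.
    eapply comp_ext; [| apply R].
    - intros [p t] _. unfold conf. simpl. induction t; simpl; congruence.
    - unfold eval_at. comp.
    - apply (comp_app _ step); [apply comp_step | comp]. }
  assert (Hh : comp total (fun q : nat * nat * nat =>
                 if halted (conf (fst q) (snd q)) then 0 else 1)).
  { apply (comp_app _ (fun s => if halted s then 0 else 1)
             (fun q => conf (fst q) (snd q))); [| exact Hc].
    unfold halted. comp. }
  assert (Ho : comp total (fun q : nat * nat * nat =>
                 fst (snd (snd (conf (fst q) (snd q)))))) by comp.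
  destruct Hh as [Ph HPh], Ho as [Po HPo].
  exists (PComp Po (PPair PId (PMu Ph))). intros e x y [P [<- R]].
  destruct (runs_reaches P x y R 0) as [n Hn].
  pose (h := fun t => halted (conf (code_prog P, x) t) = true).
  assert (Hnh : h n).
  { unfold h, conf. simpl fst. simpl snd. now rewrite Hn. }
  destruct (least_witness h n Hnh) as [k [Hk Hlt]].
  assert (Hkn : k <= n) by (destruct (Nat.le_gt_cases k n); [assumption | firstorder]).
  assert (E : conf (code_prog P, x) k = return_to y 0).
  { unfold conf in *. simpl fst in *. simpl snd in *. rewrite <- Hn.
    replace n with (n - k + k) by lia. rewrite Nat.iter_add.
    induction (n - k); simpl; [reflexivity |].
    rewrite <- IHn0. symmetry. apply halted_step. exact Hk. }
  econstructor.
  - constructor; [apply runs_id |].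
    apply (runs_mu Ph _ k).
    + specialize (HPh (code_prog P, x, k) I). cbn [fst snd] in HPh.
      unfold h in Hk. rewrite Hk in HPh. exact HPh.
    + intros i Hi. exists 0.
      specialize (HPh (code_prog P, x, i) I). cbn [fst snd] in HPh.
      specialize (Hlt i Hi). unfold h in Hlt.
      destruct (halted (conf (code_prog P, x) i)); [now elim Hlt | exact HPh].
  - specialize (HPo (code_prog P, x, k) I). cbn [fst snd] in HPo.
    rewrite E in HPo. exact HPo.
Qed.

(** This is how computed indices are used: as oracles for the functions that
    they compute. *)
Lemma comp_univ {A B C} `{Enc A} `{Enc B} `{Enc C} (D : A -> Prop)
  (e : A -> nat) (x : A -> C) (F : A -> B) :
  comp D e -> comp D x ->
  (forall a, D a -> computes (e a) (code (x a)) (code (F a))) -> comp D F.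
Proof.
  intros [Pe He] [Px Hx] HF. destruct universal_program as [U HU].
  exists (PComp U (PPair Pe Px)). intros a Ha. econstructor.
  - constructor; [apply He, Ha | apply Hx, Ha].
  - apply HU, HF, Ha.
Qed.

(** The s-m-n function for one parameter; the recursion in it produces the code
    of [PConst c]. *)
Definition smn (e c : nat) : nat :=
  pr 5 (pr e (pr 4 (pr
    (nat_rect (fun _ => nat) (code_prog PZero)
       (fun _ r => pr 5 (pr (code_prog PSucc) r)) c)
    (code_prog PId)))).

Lemma code_smn P c :
  code_prog (PComp P (PPair (PConst c) PId)) = smn (code_prog P) c.
Proof.
  unfold smn. cbn [code_prog]. do 4 f_equal.
  induction c; simpl; congruence.
Qed.

Lemma runs_smn P c x y :
  runs P (pr c x) y -> runs (PComp P (PPair (PConst c) PId)) x y.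
Proof.
  intros R. econstructor; [| exact R].
  constructor; [apply runs_const | apply runs_id].
Qed.

Lemma comp_smn : comp total (fun p : nat * nat => smn (fst p) (snd p)).
Proof.
  unfold smn.
  assert (R : comp total (fun c : nat => nat_rect (fun _ => nat) (code_prog PZero)
                (fun _ r => pr 5 (pr (code_prog PSucc) r)) c)).
  { pose proof (comp_natrec (fun _ : nat => code_prog PZero)
      (fun x => pr 5 (pr (code_prog PSucc) (snd (snd x))))
      ltac:(comp) ltac:(comp)) as R.
    apply (comp_app _ _ (fun x : nat => (x, x)) R). comp. }
  comp. apply (comp_app _ _ _ R). comp.
Qed.

(** Kleene's recursion theorem: a program can use its own index.  Therefore, to
    compute [F], it is enough to compute each of its values, uniformly, from an
    index that is only known to give the values at arguments of smaller measure;
    the domain of the assumption expresses what is known of the index. *)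
Lemma comp_fix {A B} `{Enc A} `{Enc B} (m : A -> nat) (D : A -> Prop) (F : A -> B) :
  comp (fun x : nat * A => D (snd x) /\
          forall a, D a -> m a < m (snd x) -> computes (fst x) (code a) (code (F a)))
       (fun x => F (snd x)) ->
  comp D F.
Proof.
  intros [Q HQ].
  assert (Hd : comp total (fun z : nat => smn z z)).
  { apply (comp_app _ (fun p => smn (fst p) (snd p)) (fun z : nat => (z, z)));
      [apply comp_smn | comp]. }
  destruct Hd as [S HS].
  (* The diagonal program [W] maps (z, x) to Q(smn z z, x); the fixed point is
     [W] applied to its own code. *)
  set (W := PComp Q (PPair (PComp S PFst) PSnd)).
  exists (PComp W (PPair (PConst (code_prog W)) PId)).
  intros a. induction a as [a IH] using (well_founded_induction (well_founded_ltof _ m)).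
  intros Ha. apply runs_smn. unfold W at 1. econstructor.
  - constructor; [econstructor; [constructor | apply (HS (code_prog W)); exact I]
                 | constructor].
  - apply (HQ (smn (code_prog W) (code_prog W), a)). split; [exact Ha |].
    intros a' Ha' Hlt. exists (PComp W (PPair (PConst (code_prog W)) PId)).
    split; [apply code_smn | apply IH; assumption].
Qed.

(** * Lists and formulas as data *)

Fixpoint encode_list {A} `{Enc A} (l : list A) : nat :=
  match l with [] => 0 | a :: l' => S (pr (code a) (encode_list l')) end.
#[export] Instance enc_list {A} `{Enc A} : Enc (list A) := encode_list.
#[export] Instance enc_form : Enc form := code_form.
#[export] Instance enc_pform : Enc pform := code_pform.

Lemma code_list_map {A} `{Enc A} (l : list A) :
  code_list (map code l) = code l.
Proof.
  induction l as [| a l IH]; [reflexivity |].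
  simpl code_list. rewrite IH. reflexivity.
Qed.

Lemma code_list_code (l : list nat) : code_list l = code l.
Proof. rewrite <- code_list_map. f_equal. symmetry. apply map_id. Qed.

Lemma code_vars_code (vs : list var) : code_vars vs = code vs.
Proof. apply code_list_map. Qed.

Lemma comp_encoding {A B} `{Enc A} `{Enc B} (D : A -> Prop) (f : A -> B) :
  comp D f -> comp D (fun x => code (f x)).
Proof. apply comp_code. reflexivity. Qed.

Lemma comp_cons {A E} `{Enc A} `{Enc E} (D : A -> Prop)
  (f : A -> E) (g : A -> list E) :
  comp D f -> comp D g -> comp D (fun x => f x :: g x).
Proof.
  intros Hf Hg. apply (comp_code D (fun x => S (code (f x, g x)))); [reflexivity |].
  apply comp_S, comp_encoding. comp.
Qed.

Ltac comp_more ::= first [ simple apply comp_cons | comp_bool ].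

(** The branch for nonempty lists receives head and tail as additional inputs;
    they are not functions of [a] in the statement because a total head
    function would need a default value. *)
Lemma comp_list_case {A B E} `{Enc A} `{Enc B} `{Enc E} (D : A -> Prop)
  (f : A -> list E) (F : A -> B) :
  comp D f ->
  comp (fun a => D a /\ f a = []) F ->
  comp (fun x : A * (E * list E) => D (fst x) /\ f (fst x) = fst (snd x) :: snd (snd x))
       (fun x => F (fst x)) ->
  comp D F.
Proof.
  intros Hf HF [P HP].
  apply (comp_ext D (fun a => if code (f a) =? 0 then F a else F a)).
  { intros a _. now destruct (code (f a) =? 0). }
  apply comp_if.
  - pose proof (comp_encoding D f Hf). comp.
  - eapply comp_weaken; [| exact HF]. intros a [Ha E0]. split; [assumption |].
    destruct (f a); [reflexivity | discriminate].
  - destruct Hf as [Q HQ].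
    assert (Hp : comp D (fun a => pred (code (f a)))).
    { apply comp_pred, comp_encoding. now exists Q. }
    destruct Hp as [R HR]. exists (PComp P (PPair PId R)). intros a [Ha E0].
    destruct (f a) as [| e l] eqn:Ef; [discriminate |]. econstructor.
    + constructor; [apply runs_id | apply HR, Ha].
    + specialize (HP (a, (e, l))). rewrite Ef. apply HP. split; assumption.
Qed.

Lemma comp_list_rec {A B E} `{Enc A} `{Enc B} `{Enc E}
  (F : A -> list E -> B) (z : A -> B) (g : A * (E * (list E * B)) -> B) :
  comp total z -> comp total g ->
  (forall a, F a [] = z a) ->
  (forall a e l, F a (e :: l) = g (a, (e, (l, F a l)))) ->
  comp total (fun p => F (fst p) (snd p)).
Proof.
  intros Hz Hg E0 E1. apply (comp_fix (fun p => length (snd p))).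
  apply (comp_list_case _ (fun x => snd (snd x))).
  - comp.
  - apply (comp_ext _ (fun x => z (fst (snd x)))).
    + intros [e [a l]] [_ El]. simpl in *. rewrite El. apply E0.
    + apply (comp_app _ z); [assumption | comp].
  - apply (comp_ext _ (fun x => g (fst (snd (fst x)), (fst (snd x),
             (snd (snd x), F (fst (snd (fst x))) (snd (snd x))))))).
    + intros [[e [a l]] [h t]] [_ El]. simpl in *. rewrite El. apply E1.
    + apply (comp_app _ g); [assumption |]. comp.
      apply (comp_univ _ (fun x => fst (fst x))
               (fun x => (fst (snd (fst x)), snd (snd x)))); [comp | comp |].
      intros [[e [a l]] [h t]] [[_ He] El]. simpl in *.
      apply (He (a, t) I). rewrite El. simpl. lia.
Qed.

Section Lists.
Context {A E : Type} `{Enc A} `{Enc E} (D : A -> Prop).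

Lemma comp_length (l : A -> list E) : comp D l -> comp D (fun x => length (l x)).
Proof.
  apply comp_app.
  pose proof (comp_list_rec (fun (_ : nat) (l : list E) => length l)
    (fun _ => 0) (fun x => S (snd (snd (snd x)))) ltac:(comp) ltac:(comp)
    ltac:(reflexivity) ltac:(reflexivity)) as R.
  apply (comp_app total _ (fun l => (0, l)) R). comp.
Qed.

Lemma comp_append (l1 l2 : A -> list E) :
  comp D l1 -> comp D l2 -> comp D (fun x => l1 x ++ l2 x).
Proof.
  intros H1 H2. apply (comp_app2 D (fun a b => b ++ a) l2 l1); [| assumption ..].
  apply (comp_list_rec (fun a b => b ++ a) (fun a => a)
           (fun x => fst (snd x) :: snd (snd (snd x)))); try reflexivity; comp.
Qed.

Lemma comp_map {B} `{Enc B} (h : A -> E -> B) (l : A -> list E) :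
  comp total (fun p => h (fst p) (snd p)) -> comp D l ->
  comp D (fun x => map (h x) (l x)).
Proof.
  intros Hh Hl.
  apply (comp_app2 D (fun a l => map (h a) l) (fun x => x) l); [| comp | assumption].
  apply (comp_list_rec (fun a l => map (h a) l) (fun _ => [])
           (fun x => h (fst x) (fst (snd x)) :: snd (snd (snd x))));
    try reflexivity; comp.
  apply (comp_app2 total h); [assumption | comp | comp].
Qed.

Lemma comp_forallb (h : A -> E -> bool) (l : A -> list E) :
  comp total (fun p => h (fst p) (snd p)) -> comp D l ->
  comp D (fun x => forallb (h x) (l x)).
Proof.
  intros Hh Hl.
  apply (comp_app2 D (fun a l => forallb (h a) l) (fun x => x) l); [| comp | assumption].
  apply (comp_list_rec (fun a l => forallb (h a) l) (fun _ => true)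
           (fun x => h (fst x) (fst (snd x)) && snd (snd (snd x))));
    try reflexivity; comp.
  apply (comp_app2 total h); [assumption | comp | comp].
Qed.

Lemma comp_combine {B} `{Enc B} (l1 : A -> list E) (l2 : A -> list B) :
  comp D l1 -> comp D l2 -> comp D (fun x => combine (l1 x) (l2 x)).
Proof.
  apply (comp_app2 D (@combine E B)).
  apply (comp_fix (fun p => length (fst p))).
  apply (comp_list_case _ (fun x => fst (snd x))); [comp | |].
  { apply (comp_ext _ (fun _ => [])); [| comp].
    intros [e [m1 m2]] [_ E1]. simpl in *. now rewrite E1. }
  apply (comp_list_case _ (fun x => snd (snd (fst x)))); [comp | |].
  { apply (comp_ext _ (fun _ => [])); [| comp].
    intros [[e [m1 m2]] [h1 t1]] [[_ E1] E2]. simpl in *. now rewrite E1, E2. }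
  apply (comp_ext _ (fun x => (fst (snd (fst x)), fst (snd x))
                       :: combine (snd (snd (fst x))) (snd (snd x)))).
  - intros [[[e [m1 m2]] [h1 t1]] [h2 t2]] [[_ E1] E2]. simpl in *.
    now rewrite E1, E2.
  - comp. apply (comp_univ _ (fun x => fst (fst (fst x)))
             (fun x => (snd (snd (fst x)), snd (snd x)))); [comp | comp |].
    intros [[[e [m1 m2]] [h1 t1]] [h2 t2]] [[[_ He] E1] E2]. simpl in *.
    apply (He (t1, t2) I). rewrite E1. simpl. lia.
Qed.

Lemma comp_fold_left {B} `{Enc B} (h : A -> B -> E -> B)
  (l : A -> list E) (b : A -> B) :
  comp total (fun p => h (fst p) (fst (snd p)) (snd (snd p))) ->
  comp D l -> comp D b ->
  comp D (fun x => fold_left (h x) (l x) (b x)).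
Proof.
  intros Hh Hl Hb.
  apply (comp_app2 D (fun p l => fold_left (h (fst p)) l (snd p))
           (fun x => (x, b x)) l); [| comp | assumption].
  apply (comp_fix (fun p => length (snd p))).
  apply (comp_list_case _ (fun x => snd (snd x))); [comp | |].
  { apply (comp_ext _ (fun x => snd (fst (snd x)))); [| comp].
    intros [e [p m]] [_ E1]. simpl in *. now rewrite E1. }
  set (p' := fun x : nat * (A * B * list E) * (E * list E) =>
    (fst (fst (snd (fst x))),
     h (fst (fst (snd (fst x)))) (snd (fst (snd (fst x)))) (fst (snd x)))).
  apply (comp_ext _ (fun x => fold_left (h (fst (p' x))) (snd (snd x)) (snd (p' x)))).
  - intros [[e [[a c] m]] [h1 t1]] [_ E1]. simpl in *. now rewrite E1.
  - apply (comp_univ _ (fun x => fst (fst x)) (fun x => (p' x, snd (snd x)))); [comp | |].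
    + unfold p'. comp.
      apply (comp_app _ (fun p => h (fst p) (fst (snd p)) (snd (snd p)))
               (fun x => (fst (fst (snd (fst x))),
                  (snd (fst (snd (fst x))), fst (snd x)))) Hh). comp.
    + intros [[e [[a c] m]] [h1 t1]] [[_ He] E1]. simpl in *.
      apply (He (_, _, t1) I). rewrite E1. simpl. lia.
Qed.

End Lists.

(** ** Constructors and selectors of formulas *)

Definition head (f : form) : nat :=
  match f with
  | Fal => 0 | Rel _ _ => 1 | Eq _ _ => 2 | Neg _ => 3
  | And _ _ => 4 | Or _ _ => 5 | Ex _ _ => 6 | All _ _ => 7
  end.

Definition arg1 (f : form) : form :=
  match f with
  | Neg g | And g _ | Or g _ | Ex _ g | All _ g => g
  | _ => Fal
  end.

Definition arg2 (f : form) : form :=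
  match f with And _ g | Or _ g => g | _ => Fal end.

Definition bound_var (f : form) : nat * nat :=
  match f with Ex v _ | All v _ => v | _ => (0, 0) end.

Definition rel_symbol (f : form) : nat :=
  match f with Rel i _ => i | _ => 0 end.

Definition rel_vars (f : form) : list (nat * nat) :=
  match f with Rel _ vs => vs | _ => [] end.

Definition eq_vars (f : form) : (nat * nat) * (nat * nat) :=
  match f with Eq v w => (v, w) | _ => ((0, 0), (0, 0)) end.

Section Forms.
Context {A : Type} `{Enc A} (D : A -> Prop).

Lemma comp_head (f : A -> form) : comp D f -> comp D (fun x => head (f x)).
Proof.
  intros Hf. apply (comp_ext _ (fun x => p1 (code (f x)))).
  - intros a _. unfold code, enc_form. destruct (f a); simpl; now rewrite p1_pr.
  - apply comp_p1, comp_encoding, Hf.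
Qed.

Lemma comp_arg1 (f : A -> form) : comp D f -> comp D (fun x => arg1 (f x)).
Proof.
  intros Hf. pose proof (comp_head f Hf). apply comp_encoding in Hf.
  apply (comp_code D (fun x => if head (f x) <=? 2 then pr 0 0
    else if head (f x) =? 3 then p2 (code (f x))
    else if head (f x) <=? 5 then p1 (p2 (code (f x))) else p2 (p2 (code (f x)))));
    [| comp].
  intros a _. unfold code, enc_form, enc_nat.
  destruct (f a); simpl; now rewrite ?p2_pr, ?p1_pr, ?p2_pr.
Qed.

Lemma comp_arg2 (f : A -> form) : comp D f -> comp D (fun x => arg2 (f x)).
Proof.
  intros Hf. pose proof (comp_head f Hf). apply comp_encoding in Hf.
  apply (comp_code D (fun x => if (head (f x) =? 4) || (head (f x) =? 5)
    then p2 (p2 (code (f x))) else pr 0 0)); [| comp].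
  intros a _. unfold code, enc_form, enc_nat.
  destruct (f a); simpl; now rewrite ?p2_pr.
Qed.

Lemma comp_bound_var (f : A -> form) :
  comp D f -> comp D (fun x => bound_var (f x)).
Proof.
  intros Hf. pose proof (comp_head f Hf). apply comp_encoding in Hf.
  apply (comp_code D (fun x => if 6 <=? head (f x)
    then p1 (p2 (code (f x))) else pr 0 0)); [| comp].
  intros a _. unfold code, enc_form, enc_nat.
  destruct (f a); simpl; rewrite ?p2_pr, ?p1_pr; reflexivity.
Qed.

Lemma comp_rel_symbol (f : A -> form) :
  comp D f -> comp D (fun x => rel_symbol (f x)).
Proof.
  intros Hf. pose proof (comp_head f Hf). apply comp_encoding in Hf.
  apply (comp_code D (fun x => if head (f x) =? 1
    then p1 (p2 (code (f x))) else 0)); [| comp].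
  intros a _. unfold code, enc_form, enc_nat.
  destruct (f a); simpl; rewrite ?p2_pr, ?p1_pr; reflexivity.
Qed.

Lemma comp_rel_vars (f : A -> form) :
  comp D f -> comp D (fun x => rel_vars (f x)).
Proof.
  intros Hf. pose proof (comp_head f Hf). apply comp_encoding in Hf.
  apply (comp_code D (fun x => if head (f x) =? 1
    then p2 (p2 (code (f x))) else 0)); [| comp].
  intros a _. unfold code at 2 3, enc_form, enc_nat.
  destruct (f a); simpl; rewrite ?p2_pr, ?p2_pr; try reflexivity.
  symmetry. apply code_vars_code.
Qed.

Lemma comp_eq_vars (f : A -> form) :
  comp D f -> comp D (fun x => eq_vars (f x)).
Proof.
  intros Hf. pose proof (comp_head f Hf). apply comp_encoding in Hf.
  apply (comp_code D (fun x => if head (f x) =? 2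
    then p2 (code (f x)) else pr (pr 0 0) (pr 0 0))); [| comp].
  intros a _. unfold code, enc_form, enc_nat.
  destruct (f a); simpl; rewrite ?p2_pr, ?p2_pr; reflexivity.
Qed.

Lemma comp_Neg (f : A -> form) : comp D f -> comp D (fun x => Neg (f x)).
Proof.
  intros Hf. apply (comp_code _ (fun x => (3, f x))); [reflexivity | comp].
Qed.

Lemma comp_And (f g : A -> form) :
  comp D f -> comp D g -> comp D (fun x => And (f x) (g x)).
Proof.
  intros Hf Hg. apply (comp_code _ (fun x => (4, (f x, g x)))); [reflexivity | comp].
Qed.

Lemma comp_Or (f g : A -> form) :
  comp D f -> comp D g -> comp D (fun x => Or (f x) (g x)).
Proof.
  intros Hf Hg. apply (comp_code _ (fun x => (5, (f x, g x)))); [reflexivity | comp].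
Qed.

Lemma comp_Ex (v : A -> nat * nat) (f : A -> form) :
  comp D v -> comp D f -> comp D (fun x => Ex (v x) (f x)).
Proof.
  intros Hf Hg. apply (comp_code _ (fun x => (6, (v x, f x)))); [reflexivity | comp].
Qed.

Lemma comp_All (v : A -> nat * nat) (f : A -> form) :
  comp D v -> comp D f -> comp D (fun x => All (v x) (f x)).
Proof.
  intros Hf Hg. apply (comp_code _ (fun x => (7, (v x, f x)))); [reflexivity | comp].
Qed.

Lemma comp_Eq (v w : A -> nat * nat) :
  comp D v -> comp D w -> comp D (fun x => Eq (v x) (w x)).
Proof.
  intros Hf Hg. apply (comp_code _ (fun x => (2, (v x, w x)))); [reflexivity | comp].
Qed.

Lemma comp_Rel (i : A -> nat) (vs : A -> list (nat * nat)) :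
  comp D i -> comp D vs -> comp D (fun x => Rel (i x) (vs x)).
Proof.
  intros Hf Hg. apply (comp_code _ (fun x => (1, (i x, vs x)))); [| comp].
  intros a _. unfold code at 1, enc_form. simpl. now rewrite code_vars_code.
Qed.

Lemma code_pform_code (p : pform) : code p = code (body p, (pxs p, pys p)).
Proof.
  unfold code at 1, enc_pform, code_pform. now rewrite !code_vars_code.
Qed.

Lemma comp_body (p : A -> pform) : comp D p -> comp D (fun x => body (p x)).
Proof.
  intros Hp. apply (comp_fst D (fun x => (body (p x), (pxs (p x), pys (p x))))).
  apply (comp_code D p); [| assumption]. intros. symmetry. apply code_pform_code.
Qed.

Lemma comp_pxs (p : A -> pform) :
  comp D p -> comp D (fun x => pxs (p x) : list (nat * nat)).
Proof.
  intros Hp. apply (comp_fst D (fun x => (pxs (p x), pys (p x)))).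
  apply (comp_snd D (fun x => (body (p x), (pxs (p x), pys (p x))))).
  apply (comp_code D p); [| assumption]. intros. symmetry. apply code_pform_code.
Qed.

Lemma comp_pys (p : A -> pform) :
  comp D p -> comp D (fun x => pys (p x) : list (nat * nat)).
Proof.
  intros Hp. apply (comp_snd D (fun x => (pxs (p x), pys (p x)))).
  apply (comp_snd D (fun x => (body (p x), (pxs (p x), pys (p x))))).
  apply (comp_code D p); [| assumption]. intros. symmetry. apply code_pform_code.
Qed.

End Forms.

Ltac comp_more ::=
  first [ simple apply comp_cons | simple eapply comp_length
        | simple apply comp_append | simple apply comp_combine
        | simple apply comp_head | simple apply comp_arg1 | simple apply comp_arg2
        | simple apply comp_bound_var | simple apply comp_rel_symbol
        | simple apply comp_rel_vars | simple apply comp_eq_vars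
        | simple apply comp_Neg | simple apply comp_And | simple apply comp_Or
        | simple apply comp_Ex | simple apply comp_All
        | simple apply comp_Eq | simple apply comp_Rel
        | simple apply comp_body | simple apply comp_pxs | simple apply comp_pys
        | comp_bool ].

(** ** Structural recursion on formulas *)

Definition on_arg1 {B} (F : form -> B) (b : B) (f : form) : B :=
  if 3 <=? head f then F (arg1 f) else b.

Definition on_arg2 {B} (F : form -> B) (b : B) (f : form) : B :=
  if (head f =? 4) || (head f =? 5) then F (arg2 f) else b.

Fixpoint form_size (f : form) : nat :=
  match f with
  | Fal | Rel _ _ | Eq _ _ => 0
  | Neg f | Ex _ f | All _ f => S (form_size f)
  | And f g | Or f g => S (form_size f + form_size g)
  end.

(** The step [g] is applied to the values at the immediate subformulas, with the
    default [b] where there is none; so it can be written as a case distinction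
    on [head f] all of whose branches are defined. *)
Lemma comp_form_rec {A B} `{Enc A} `{Enc B} (F : A -> form -> B) (b : B)
  (g : A * (form * (B * B)) -> B) :
  comp total g ->
  (forall a f, F a f = g (a, (f, (on_arg1 (F a) b f, on_arg2 (F a) b f)))) ->
  comp total (fun p => F (fst p) (snd p)).
Proof.
  intros Hg EF. apply (comp_fix (fun p => form_size (snd p))).
  eapply comp_ext; [intros x _; apply EF |].
  apply (comp_app _ g); [assumption |]. unfold on_arg1, on_arg2.
  do 2 (apply comp_pair; [comp |]). apply comp_pair.
  - apply comp_if; [comp | | comp].
    apply (comp_univ _ fst (fun x => (fst (snd x), arg1 (snd (snd x))))); [comp | comp |].
    intros [e [a f]] [[_ He] Hh]. simpl in *. apply (He (a, arg1 f) I).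
    destruct f; try discriminate; simpl; lia.
  - apply comp_if; [comp | | comp].
    apply (comp_univ _ fst (fun x => (fst (snd x), arg2 (snd (snd x))))); [comp | comp |].
    intros [e [a f]] [[_ He] Hh]. simpl in *. apply (He (a, arg2 f) I).
    destruct f; try discriminate; simpl; lia.
Qed.

(** * Decoding *)

(** Decoding is total, with junk values at numbers that are not codes, so that
    a quantifier over the type is a quantifier over all numbers. *)
Class Dec (A : Type) `{Enc A} := {
  decode : nat -> A;
  decode_code : forall a, decode (code a) = a;
  comp_decode_all : comp total decode
}.

Lemma comp_decode {A B} `{Enc A} `{Dec B} (D : A -> Prop) (f : A -> nat) :
  comp D f -> comp D (fun x => decode (f x)).
Proof. apply comp_app, comp_decode_all. Qed.

Lemma code_inj {A} `{Dec A} (a b : A) : code a = code b -> a = b.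
Proof. intros E. rewrite <- (decode_code a), E. apply decode_code. Qed.

#[export] Instance dec_nat : Dec nat.
Proof. exists (fun n => n); [reflexivity | comp]. Defined.

#[export] Instance dec_bool : Dec bool.
Proof. exists (fun n => n =? 1); [now intros [] | comp]. Defined.

#[export] Instance dec_prod {A B} `{Dec A} `{Dec B} : Dec (A * B).
Proof.
  exists (fun n => (decode (p1 n), decode (p2 n))).
  - intros [a b]. unfold code, enc_prod. simpl.
    now rewrite p1_pr, p2_pr, !decode_code.
  - apply comp_pair; apply comp_decode; comp.
Defined.

(** The components of a code are smaller than the code, which thus bounds the
    depth of the recursion. *)
Fixpoint decode_list {A} `{Dec A} (fuel n : nat) : list A :=
  match fuel with
  | 0 => []
  | S fuel' =>
      if n =? 0 then [] else decode (p1 (pred n)) :: decode_list fuel' (p2 (pred n))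
  end.

#[export] Instance dec_list {A} `{Dec A} : Dec (list A).
Proof.
  exists (fun n => decode_list (S n) n).
  - intros l.
    enough (L : forall n, code l < n -> decode_list n (code l) = l) by (apply L; lia).
    induction l as [| a l IH]; intros [| n] Hn; try reflexivity; [lia |].
    unfold code, enc_list in *. simpl in *.
    pose proof (pr_ge (code a) (encode_list l)).
    rewrite p1_pr, p2_pr, decode_code, IH by lia. reflexivity.
  - assert (R : comp total (fun p => decode_list (fst p) (snd p) : list A)).
    { apply (comp_fix fst).
      apply (comp_ext _ (fun x => if (fst (snd x) =? 0) || (snd (snd x) =? 0) then []
        else decode (p1 (pred (snd (snd x))))
             :: decode_list (pred (fst (snd x))) (p2 (pred (snd (snd x)))))).
      { intros [e [[| n] x]] _; simpl; [reflexivity |]. now destruct x. }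
      apply comp_if; [comp | comp |]. apply comp_cons; [apply comp_decode; comp |].
      apply (comp_univ _ fst (fun x => (pred (fst (snd x)), p2 (pred (snd (snd x))))));
        [comp | comp |].
      intros [e [n x]] [[_ He] Hn]. simpl in *.
      apply (He (pred n, p2 (pred x)) I). destruct n; [discriminate | simpl; lia]. }
    apply (comp_app _ _ (fun n : nat => (S n, n)) R). comp.
Defined.

Fixpoint decode_form (fuel n : nat) : form :=
  match fuel with
  | 0 => Fal
  | S k =>
      let b := p2 n in
      if p1 n =? 1 then Rel (p1 b) (decode (p2 b))
      else if p1 n =? 2 then Eq (decode (p1 b)) (decode (p2 b))
      else if p1 n =? 3 then Neg (decode_form k b)
      else if p1 n =? 4 then And (decode_form k (p1 b)) (decode_form k (p2 b))
      else if p1 n =? 5 then Or (decode_form k (p1 b)) (decode_form k (p2 b))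
      else if p1 n =? 6 then Ex (decode (p1 b)) (decode_form k (p2 b))
      else if p1 n =? 7 then All (decode (p1 b)) (decode_form k (p2 b))
      else Fal
  end.

Lemma decode_form_code f n : code_form f < n -> decode_form n (code_form f) = f.
Proof.
  revert n. induction f; intros [| n] Hn; try reflexivity; try lia;
    cbn [code_form decode_form] in *; rewrite p1_pr, p2_pr; cbn [Nat.eqb].
  1,2: rewrite p1_pr, p2_pr, ?code_vars_code; f_equal; apply decode_code.
  1: pose proof (pr_ge 3 (code_form f)); now rewrite IHf by lia.
  1,2: match type of Hn with pr ?t ?p < _ => pose proof (pr_ge t p) end;
       pose proof (pr_ge (code_form f1) (code_form f2));
       rewrite p1_pr, p2_pr, IHf1, IHf2 by lia; reflexivity.
  1,2: match type of Hn with pr ?t ?p < _ => pose proof (pr_ge t p) end;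
       pose proof (pr_ge (code_var v) (code_form f));
       rewrite p1_pr, p2_pr, IHf by lia; f_equal; apply decode_code.
Qed.

#[export] Instance dec_form : Dec form.
Proof.
  exists (fun n => decode_form (S n) n).
  - intros f. apply decode_form_code, Nat.lt_succ_diag_r.
  - assert (R : comp total (fun p => decode_form (fst p) (snd p))).
    { apply (comp_fix fst).
      set (b := fun x : nat * (nat * nat) => p2 (snd (snd x))).
      set (r := fun (x : nat * (nat * nat)) n => decode_form (pred (fst (snd x))) n).
      apply (comp_ext _ (fun x => if fst (snd x) =? 0 then Fal
        else if p1 (snd (snd x)) =? 1 then Rel (p1 (b x)) (decode (p2 (b x)))
        else if p1 (snd (snd x)) =? 2 then Eq (decode (p1 (b x))) (decode (p2 (b x)))
        else if p1 (snd (snd x)) =? 3 then Neg (r x (b x))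
        else if p1 (snd (snd x)) =? 4 then And (r x (p1 (b x))) (r x (p2 (b x)))
        else if p1 (snd (snd x)) =? 5 then Or (r x (p1 (b x))) (r x (p2 (b x)))
        else if p1 (snd (snd x)) =? 6 then Ex (decode (p1 (b x))) (r x (p2 (b x)))
        else if p1 (snd (snd x)) =? 7 then All (decode (p1 (b x))) (r x (p2 (b x)))
        else Fal)).
      { now intros [e [[| n] x]] _. }
      apply comp_if; [comp | comp |].
      match goal with |- comp ?D _ => assert (Hb : comp D b) by (unfold b; comp) end.
      match goal with |- comp ?D _ => assert (Hr : forall h, comp D h ->
        comp D (fun x => r x (h x))) end.
      { intros h Hh.
        apply (comp_univ _ fst (fun x => (pred (fst (snd x)), h x))); [comp | comp |].
        intros [e [n x]] [[_ He] Hn]. simpl in *.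
        apply (He (pred n, _) I). destruct n; [discriminate | simpl; lia]. }
      comp; first [apply Hr | apply (comp_decode (B := nat * nat))
                  | apply (comp_decode (B := list (nat * nat)))]; comp. }
    apply (comp_app _ _ (fun n : nat => (S n, n)) R). comp.
Defined.

#[export] Instance dec_pform : Dec pform.
Proof.
  exists (fun n => let d := decode (A := form * (list (nat * nat) * list (nat * nat))) n in
            {| body := fst d; pxs := fst (snd d); pys := snd (snd d) |}).
  - intros p. cbv zeta. rewrite code_pform_code.
    change (list var) with (list (nat * nat)). rewrite decode_code. now destruct p.
  - apply (comp_code total (fun n : nat =>
             decode (A := form * (list (nat * nat) * list (nat * nat))) n));
      [| apply comp_decode_all].
    intros n _. rewrite code_pform_code. cbn [body pxs pys].
    now rewrite <- !surjective_pairing.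
Defined.

(** * Decidable predicates *)

(** Deciding truth classically turns predicates into functions, so that one
    notion of computability serves for both. *)
Definition truth (P : Prop) : bool :=
  if excluded_middle_informative P then true else false.

Lemma truth_true P : truth P = true <-> P.
Proof. unfold truth. destruct (excluded_middle_informative P); split; congruence || tauto. Qed.

Lemma truth_false P : truth P = false <-> ~ P.
Proof. unfold truth. destruct (excluded_middle_informative P); split; congruence || tauto. Qed.

Lemma truth_eq P b : (P <-> b = true) -> truth P = b.
Proof.
  intros E. destruct b; [apply truth_true | apply truth_false]; rewrite E; auto.
Qed.

Definition decid {A} `{Enc A} (R : A -> Prop) : Prop := comp total (fun a => truth (R a)).

Section Decidable.
Context {A : Type} `{Enc A}.
Implicit Types R S : A -> Prop.

Lemma decid_bool R (f : A -> bool) :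
  comp total f -> (forall a, R a <-> f a = true) -> decid R.
Proof. intros Hf E. apply (comp_ext _ f); [| assumption]. intros. now apply truth_eq. Qed.

Lemma decid_ext R S : (forall a, R a <-> S a) -> decid S -> decid R.
Proof.
  intros E HS. apply (decid_bool _ _ HS). intros a. now rewrite truth_true.
Qed.

Lemma decid_is_true (f : A -> bool) : comp total f -> decid (fun a => f a = true).
Proof. intros Hf. now apply (decid_bool _ f). Qed.

Lemma decid_const (P : Prop) : decid (fun _ => P).
Proof. exact (comp_const total (truth P)). Qed.

Lemma decid_not R : decid R -> decid (fun a => ~ R a).
Proof.
  intros HR. apply (decid_bool _ (fun a => negb (truth (R a)))).
  - apply comp_negb, HR.
  - intros a. now rewrite negb_true_iff, truth_false.
Qed.

Lemma decid_and R S : decid R -> decid S -> decid (fun a => R a /\ S a).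
Proof.
  intros HR HS. apply (decid_bool _ (fun a => truth (R a) && truth (S a))).
  - now apply comp_andb.
  - intros a. now rewrite andb_true_iff, !truth_true.
Qed.

Lemma decid_or R S : decid R -> decid S -> decid (fun a => R a \/ S a).
Proof.
  intros HR HS. apply (decid_bool _ (fun a => truth (R a) || truth (S a))).
  - now apply comp_orb.
  - intros a. now rewrite orb_true_iff, !truth_true.
Qed.

Lemma decid_imp R S : decid R -> decid S -> decid (fun a => R a -> S a).
Proof.
  intros HR HS. apply (decid_ext _ (fun a => ~ R a \/ S a)).
  - intros a. destruct (classic (R a)); tauto.
  - apply decid_or; [apply decid_not |]; assumption.
Qed.

Lemma decid_iff R S : decid R -> decid S -> decid (fun a => R a <-> S a).
Proof. intros HR HS. apply decid_and; now apply decid_imp. Qed.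

Lemma decid_eq {B} `{Dec B} (f g : A -> B) :
  comp total f -> comp total g -> decid (fun a => f a = g a).
Proof.
  intros Hf Hg. apply (decid_bool _ (fun a => code (f a) =? code (g a))).
  - apply comp_eqb; now apply comp_encoding.
  - intros a. rewrite Nat.eqb_eq. split; [congruence | apply code_inj].
Qed.

Lemma decid_app {B} `{Enc B} (R : B -> Prop) (f : A -> B) :
  decid R -> comp total f -> decid (fun a => R (f a)).
Proof. intros HR Hf. apply (comp_app _ (fun b => truth (R b)) f); assumption. Qed.

Lemma decid_Forall {E} `{Enc E} (R : A -> E -> Prop) (l : A -> list E) :
  decid (fun p => R (fst p) (snd p)) -> comp total l ->
  decid (fun a => Forall (R a) (l a)).
Proof.
  intros HR Hl. apply (decid_bool _ (fun a => forallb (fun e => truth (R a e)) (l a))).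
  - now apply (comp_forallb _ (fun a e => truth (R a e))).
  - intros a. rewrite Forall_forall, forallb_forall.
    split; intros Ha e He; apply truth_true, Ha, He.
Qed.

End Decidable.

Lemma decid_In {A E} `{Enc A} `{Dec E} (e : A -> E) (l : A -> list E) :
  comp total e -> comp total l -> decid (fun a => In (e a) (l a)).
Proof.
  intros He Hl. apply (decid_ext _ (fun a => ~ Forall (fun x => x <> e a) (l a))).
  - intros a. rewrite Forall_forall. split.
    + intros Hi Hn. now apply (Hn _ Hi).
    + intros Hn. apply NNPP. intros Hi. apply Hn. congruence.
  - apply decid_not, (decid_Forall (fun a x => x <> e a)); [| assumption].
    apply decid_not, decid_eq; [comp |]. apply (comp_app _ e); [assumption | comp].
Qed.

Lemma decid_le {A} `{Enc A} (f g : A -> nat) :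
  comp total f -> comp total g -> decid (fun a => f a <= g a).
Proof.
  intros Hf Hg. apply (decid_bool _ (fun a => f a <=? g a)); [comp |].
  intros a. symmetry. apply Nat.leb_le.
Qed.

Ltac dec :=
  repeat lazymatch goal with
  | |- decid (fun x => @?P x /\ @?Q x) => apply (decid_and P Q)
  | |- decid (fun x => @?P x \/ @?Q x) => apply (decid_or P Q)
  | |- decid (fun x => ~ @?P x) => apply (decid_not P)
  | |- decid (fun x => @?P x -> @?Q x) => apply (decid_imp P Q)
  | |- decid (fun x => @?f x = true) => apply (decid_is_true f)
  | |- decid (fun x => @eq nat (@?f x) (@?g x)) => apply (decid_eq f g)
  | |- decid (fun x => @eq bool (@?f x) (@?g x)) => apply (decid_eq f g)
  | |- decid (fun x => @eq (nat * nat) (@?f x) (@?g x)) => apply (decid_eq f g)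
  | |- decid (fun x => @?f x <= @?g x) => apply (decid_le f g)
  | |- decid (fun x => In (@?e x) (@?l x)) => apply (decid_In e l)
  | |- comp _ _ => progress comp
  end.

Lemma decid_list_rec {A E} `{Enc A} `{Enc E} (R : A -> list E -> Prop)
  (z : A -> Prop) (G : A * (E * (list E * bool)) -> Prop) :
  decid z -> decid G ->
  (forall a, R a [] <-> z a) ->
  (forall a e l, R a (e :: l) <-> G (a, (e, (l, truth (R a l))))) ->
  decid (fun p => R (fst p) (snd p)).
Proof.
  intros Hz HG E0 E1.
  apply (comp_list_rec (fun a l => truth (R a l)) (fun a => truth (z a))
           (fun x => truth (G x))); try assumption.
  - intros a. apply truth_eq. rewrite truth_true. apply E0.
  - intros a e l. apply truth_eq. rewrite truth_true. apply E1.
Qed.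

Lemma decid_form_rec0 (R : form -> Prop) (G : form * (bool * bool) -> Prop) :
  decid G ->
  (forall f, R f <-> G (f, (on_arg1 (fun g => truth (R g)) false f,
                            on_arg2 (fun g => truth (R g)) false f))) ->
  decid R.
Proof.
  intros HG E.
  assert (S : comp total (fun p : nat * form => truth (R (snd p)))).
  { apply (comp_form_rec (fun _ f => truth (R f)) false (fun x => truth (G (snd x)))).
    - apply (comp_app _ (fun x => truth (G x))); [assumption | comp].
    - intros k f. apply truth_eq. rewrite truth_true. apply E. }
  apply (comp_app _ _ (fun f : form => (0, f)) S). comp.
Qed.

Lemma decid_form_rec {A} `{Enc A} (R : A -> form -> Prop)
  (G : A * (form * (bool * bool)) -> Prop) :
  decid G ->
  (forall a f, R a f <-> G (a, (f, (on_arg1 (fun g => truth (R a g)) false f,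
                                    on_arg2 (fun g => truth (R a g)) false f)))) ->
  decid (fun p => R (fst p) (snd p)).
Proof.
  intros HG E.
  apply (comp_form_rec (fun a f => truth (R a f)) false (fun x => truth (G x)));
    [assumption |].
  intros a f. apply truth_eq. rewrite truth_true. apply E.
Qed.

(** * The arithmetical hierarchy on coded types *)

(** [arith true k R] says that [R] is Sigma_k and [arith false k R] that it is
    Pi_k; the predicates negate into one another, so that closure properties
    need to be proved for one value of the boolean only. *)
Fixpoint arith (b : bool) (k : nat) {A : Type} {EA : Enc A} (R : A -> Prop) : Prop :=
  match k with
  | 0 => decid R
  | S k' => exists R' : A * nat -> Prop, arith (negb b) k' R' /\
      forall a, R a <-> (if b then exists y, R' (a, y) else forall y, R' (a, y))
  end.

Lemma arith_ext b k {A} `{Enc A} (R S : A -> Prop) :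
  (forall a, R a <-> S a) -> arith b k S -> arith b k R.
Proof.
  destruct k; simpl.
  - apply decid_ext.
  - intros E [R' [HR' ER']]. exists R'. split; [assumption |].
    intros a. now rewrite E.
Qed.

Lemma arith_app b k {A B} `{Enc A} `{Enc B} (R : B -> Prop) (f : A -> B) :
  arith b k R -> comp total f -> arith b k (fun a => R (f a)).
Proof.
  intros HR Hf. revert b A B H H0 R f HR Hf.
  induction k as [| k IH]; intros b A B EA EB R f; simpl.
  - apply decid_app.
  - intros [R' [HR' ER']] Hf. exists (fun p => R' (f (fst p), snd p)). split.
    + apply (IH _ _ _ _ _ R' (fun p => (f (fst p), snd p))); [assumption |].
      comp. apply (comp_app _ f); [assumption | comp].
    + intros a. apply ER'.
Qed.

Lemma arith_not b k {A} `{Enc A} (R : A -> Prop) :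
  arith b k R -> arith (negb b) k (fun a => ~ R a).
Proof.
  revert b A H R. induction k as [| k IH]; intros b A EA R; simpl.
  - apply decid_not.
  - intros [R' [HR' ER']]. exists (fun p => ~ R' p). split; [now apply IH |].
    intros a. rewrite ER'. destruct b; simpl; split.
    + intros N y Hy. apply N. eauto.
    + intros N [y Hy]. now apply (N y).
    + apply not_all_ex_not.
    + intros [y Hy] N. auto.
Qed.

(** Two quantifiers of the same kind merge into one over pairs.  This is right
    for universal quantifiers, too, as the components of the pair range
    independently over all numbers. *)
Lemma arith_and b k {A} `{Enc A} (R S : A -> Prop) :
  arith b k R -> arith b k S -> arith b k (fun a => R a /\ S a).
Proof.
  revert b A H R S. induction k as [| k IH]; intros b A EA R S; simpl.
  - apply decid_and.
  - intros [R' [HR' ER']] [S' [HS' ES']].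
    exists (fun p => R' (fst p, p1 (snd p)) /\ S' (fst p, p2 (snd p))). split.
    + apply IH; eapply arith_app; try eassumption; comp.
    + intros a. rewrite ER', ES'. cbn [fst snd]. destruct b; split.
      * intros [[y Hy] [z Hz]]. exists (pr y z). now rewrite p1_pr, p2_pr.
      * intros [y [Hy Hz]]. eauto.
      * intros [Hy Hz] y. auto.
      * intros Ha. split; intros y.
        -- specialize (Ha (pr y 0)). rewrite p1_pr in Ha. apply Ha.
        -- specialize (Ha (pr 0 y)). rewrite p2_pr in Ha. apply Ha.
Qed.

Lemma arith_or b k {A} `{Enc A} (R S : A -> Prop) :
  arith b k R -> arith b k S -> arith b k (fun a => R a \/ S a).
Proof.
  intros HR HS. apply arith_not in HR, HS.
  rewrite <- (negb_involutive b). eapply arith_ext;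
    [| apply arith_not, (arith_and _ _ _ _ HR HS)].
  intros a. cbn beta. destruct (classic (R a)), (classic (S a)); tauto.
Qed.

Lemma arith_imp b k {A} `{Enc A} (R S : A -> Prop) :
  arith (negb b) k R -> arith b k S -> arith b k (fun a => R a -> S a).
Proof.
  intros HR HS. apply arith_not in HR. rewrite negb_involutive in HR.
  eapply arith_ext; [| apply (arith_or _ _ _ _ HR HS)].
  intros a. cbn beta. destruct (classic (R a)); tauto.
Qed.

Lemma arith_dummy b k {A} `{Enc A} (R : A -> Prop) :
  arith (negb b) k R -> arith b (S k) R.
Proof.
  intros HR. exists (fun p => R (fst p)). split.
  - apply (arith_app _ _ R fst); [assumption | comp].
  - intros a. simpl. destruct b; split.
    + intros Ha. now exists 0.
    + now intros [_ Ha].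
    + intros Ha _. exact Ha.
    + intros Ha. exact (Ha 0).
Qed.

(** A vacuous quantifier is added outside to change the kind of the outermost
    quantifier, and inside to keep it. *)
Lemma arith_succ b b' k {A} `{Enc A} (R : A -> Prop) :
  arith b k R -> arith b' (S k) R.
Proof.
  assert (L : forall k b A (EA : Enc A) (R : A -> Prop), arith b k R -> arith b (S k) R).
  { clear. induction k as [| k IH]; intros b A EA R HR.
    - apply arith_dummy. exact HR.
    - destruct HR as [R' [HR' ER']]. exists R'. split; [now apply IH | exact ER']. }
  intros HR. destruct (bool_dec b' b) as [-> | N]; [now apply L |].
  apply arith_dummy. replace (negb b') with b by now destruct b, b'. exact HR.
Qed.

Lemma arith_le b k k' {A} `{Enc A} (R : A -> Prop) :
  k <= k' -> arith b k R -> arith b k' R.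
Proof.
  intros Hk HR. induction Hk; [assumption |]. now apply (arith_succ b).
Qed.

Lemma arith_decid b k {A} `{Enc A} (R : A -> Prop) : decid R -> arith b k R.
Proof. intros HR. apply (arith_le b 0); [lia | exact HR]. Qed.

(** The new quantifier merges with the outermost one of the prefix. *)
Lemma arith_exists k {A E} `{Enc A} `{Dec E} (R : A -> E -> Prop) :
  arith true (S k) (fun p : A * E => R (fst p) (snd p)) ->
  arith true (S k) (fun a => exists e, R a e).
Proof.
  intros [R' [HR' ER']].
  exists (fun p => R' ((fst p, decode (p1 (snd p))), p2 (snd p))). split.
  - apply (arith_app _ _ R' (fun p => ((fst p, decode (p1 (snd p))), p2 (snd p))));
      [assumption |]. comp. apply comp_decode. comp.
  - intros a. split.
    + intros [e He]. apply (ER' (a, e)) in He. destruct He as [y Hy].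
      exists (pr (code e) y). cbn [fst snd]. now rewrite p1_pr, p2_pr, decode_code.
    + intros [y Hy]. exists (decode (p1 y)). apply (ER' (a, decode (p1 y))).
      exists (p2 y). exact Hy.
Qed.

Lemma arith_forall k {A E} `{Enc A} `{Dec E} (R : A -> E -> Prop) :
  arith false (S k) (fun p : A * E => R (fst p) (snd p)) ->
  arith false (S k) (fun a => forall e, R a e).
Proof.
  intros HR. apply arith_not in HR.
  apply (arith_exists k (fun a e => ~ R a e)), arith_not in HR.
  eapply arith_ext; [| exact HR]. intros a. cbn beta. split.
  - intros Ha [e He]. auto.
  - intros N e. apply NNPP. eauto.
Qed.

(** A bounded universal quantifier over a Sigma predicate is absorbed by
    quantifying over the list of all the witnesses. *)
Lemma arith_Forall b k {A E} `{Enc A} `{Dec E} (R : A -> E -> Prop) :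
  arith b k (fun p : A * E => R (fst p) (snd p)) ->
  arith b k (fun p : A * list E => Forall (R (fst p)) (snd p)).
Proof.
  revert b A E H H0 H1 R. induction k as [| k IH]; intros b A E EA EE DE R HR.
  - apply (decid_Forall (fun (p : A * list E) e => R (fst p) e)); [| comp].
    apply (decid_app (fun p : A * E => R (fst p) (snd p))
             (fun x => (fst (fst x), snd x)) HR). comp.
  - destruct HR as [R' [HR' ER']]. simpl negb in *. destruct b.
    + exists (fun x : A * list E * nat =>
        map fst (decode (A := list (E * nat)) (snd x)) = snd (fst x) /\
        Forall (fun w : E * nat => R' (fst (fst x), fst w, snd w)) (decode (snd x))).
      split.
      * apply arith_and.
        -- apply arith_decid, decid_eq; [| comp].
           apply (comp_map _ (fun _ : A * list E * nat => @fst E nat)); [comp |].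
           apply comp_decode. comp.
        -- apply (arith_app _ _
             (fun x : A * list (E * nat) =>
                Forall (fun w => R' (fst x, fst w, snd w)) (snd x))
             (fun x : A * list E * nat => (fst (fst x), decode (snd x)))).
           ++ apply (IH _ _ _ _ _ _ (fun a (w : E * nat) => R' (a, fst w, snd w))).
              apply (arith_app _ _ R'
                (fun x : A * (E * nat) => (fst x, fst (snd x), snd (snd x)))); [assumption |].
              comp.
           ++ comp. apply comp_decode. comp.
      * intros [a l]. cbn [fst snd]. split.
        -- intros Hl. enough (Hw : exists w : list (E * nat), map fst w = l /\
             Forall (fun w => R' (a, fst w, snd w)) w).
           { destruct Hw as [w Hw]. exists (code w). now rewrite decode_code. }
           induction Hl as [| e l He Hl [w [Ew Hw]]]; [now exists [] |].
           apply (ER' (a, e)) in He. destruct He as [y Hy].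
           exists ((e, y) :: w). simpl. rewrite Ew. auto.
        -- intros [y [<- Hw]]. rewrite Forall_map.
           eapply Forall_impl; [| exact Hw]. intros [e z] Hz.
           apply (ER' (a, e)). eauto.
    + exists (fun x : A * list E * nat =>
        Forall (fun e => R' (fst (fst x), e, snd x)) (snd (fst x))). split.
      * apply (arith_app _ _
          (fun x : A * nat * list E =>
             Forall (fun e => R' (fst (fst x), e, snd (fst x))) (snd x))
          (fun x : A * list E * nat => (fst (fst x), snd x, snd (fst x)))); [| comp].
        apply (IH _ (A * nat)%type E _ _ _ (fun p e => R' (fst p, e, snd p))).
        apply (arith_app _ _ R' (fun x : A * nat * E =>
          (fst (fst x), snd x, snd (fst x)))); [assumption | comp].
      * intros [a l]. cbn [fst snd]. split.
        -- intros Hl y. eapply Forall_impl; [| exact Hl]. intros e He.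
           exact (proj1 (ER' (a, e)) He y).
        -- intros Hl. apply Forall_forall. intros e He. apply (ER' (a, e)).
           intros y. specialize (Hl y). rewrite Forall_forall in Hl. auto.
Qed.

(** The parameter is hidden in the program by the s-m-n theorem, once the
    quantifier prefix has been stripped; stripping a quantifier pairs its variable
    with the number [x], in the same way as [exists_first] does. *)
Lemma arith_index k : forall b {A J} `{Enc A} `{Enc J} (R : A -> Prop) (g : J -> nat -> A),
  arith b k R -> comp total (fun p : J * nat => g (fst p) (snd p)) ->
  exists U, forall i, exists e, runs U (code i) e /\
    if b then Sigma_index k e (fun x => R (g i x))
    else Pi_index k e (fun x => R (g i x)).
Proof.
  induction k as [| k IH]; intros b A J EA EJ R g HR Hg.
  - pose proof (comp_app _ (fun a => truth (R a)) _ HR Hg) as [P HP].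
    assert (Hs : comp total (fun i : J => smn (code_prog P) (code i))).
    { apply (comp_app2 total smn); [apply comp_smn | comp |]. apply comp_encoding. comp. }
    destruct Hs as [U HU]. exists U. intros i.
    exists (smn (code_prog P) (code i)). split.
    + apply HU. exact I.
    + assert (Hd : decides (smn (code_prog P) (code i)) (fun x => R (g i x))).
      { intros x. specialize (HP (i, x) ltac:(exact I)). cbn [fst snd] in HP.
        assert (Hc : forall y, runs P (code (i, x)) y ->
          computes (smn (code_prog P) (code i)) x y).
        { intros y Hy. eexists. split; [apply code_smn | now apply runs_smn]. }
        destruct (classic (R (g i x))) as [Hx | Hx]; [left | right];
          (split; [assumption |]; apply Hc).
        - rewrite (proj2 (truth_true _) Hx) in HP. exact HP.
        - rewrite (proj2 (truth_false _) Hx) in HP. exact HP. }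
      destruct b; exists (fun x => R (g i x)); split; auto; reflexivity.
  - destruct HR as [R' [HR' ER']].
    destruct (IH (negb b) (A * nat)%type J _ _ R'
                (fun i z => (g i (p1 z), p2 z)) HR') as [u Hu].
    { comp. apply (comp_app2 total g); [assumption | comp | comp]. }
    exists u. intros i. destruct (Hu i) as [e [He Hi]]. exists e. split; [assumption |].
    destruct b; destruct Hi as [R0 [HR0 ER0]]; exists R0; (split; [assumption |]);
      intros x; rewrite ER'; simpl; split.
    + intros [y Hy]. exists y. apply ER0. now rewrite p1_pr, p2_pr.
    + intros [y Hy]. exists y. apply ER0 in Hy. now rewrite p1_pr, p2_pr in Hy.
    + intros Hx y. apply ER0. now rewrite p1_pr, p2_pr.
    + intros Hx y. specialize (Hx y). apply ER0 in Hx. now rewrite p1_pr, p2_pr in Hx.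
Qed.

(** * Coded structures *)

(** A structure together with a code for it and the indices that the code
    yields.  The encoding keeps [ic] alone, so that computability on this type is
    uniformity in the code; in particular the indices have to be computed. *)
Record instance : Type := {
  ic : nat;
  iL : language;
  iM : structure iL;
  i_ty : nat;
  i_dom : nat;
  i_sort : nat;
  i_rel : nat;
  i_language : computes ic 0 (pr (code_bound (sorts iL)) (pr (code_bound (rels iL)) i_ty));
  i_ty_spec : forall i, below (rels iL) i -> computes i_ty i (code_list (ty iL i));
  i_structure : computes ic 1 (pr i_dom (pr i_sort i_rel));
  i_dom_spec : decides i_dom (dom iM);
  i_sort_spec : decides i_sort (coded (fun t => pr (fst t) (snd t))
                      (fun t : nat * nat => sort iM (snd t) (fst t)));
  i_rel_spec : decides i_rel (coded (fun t => pr (code_list (fst t)) (snd t))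
                      (fun t : list nat * nat => rel iM (snd t) (fst t)))
}.

#[export] Instance enc_instance : Enc instance := ic.

Lemma codes_instance (Q : nat -> forall L, structure L -> Prop) :
  (forall i, Q (ic i) (iL i) (iM i)) ->
  forall c L (M : structure L), codes c M -> Q c L M.
Proof.
  intros HQ c L M
    (l & s & Hl & (t & -> & Ht) & Hs & (ed & es & er & -> & Hd & He & Hr)).
  exact (HQ {| ic := c; iL := L; iM := M; i_ty := t; i_dom := ed; i_sort := es;
    i_rel := er; i_language := Hl; i_ty_spec := Ht; i_structure := Hs;
    i_dom_spec := Hd; i_sort_spec := He; i_rel_spec := Hr |}).
Qed.

(** A code gives the type of a relation symbol of the language only, so the
    first condition has to be tested before the second one. *)
Definition rel_of_type (L : language) (k : nat) (js : list nat) : Prop :=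
  below (rels L) k /\ js = ty L k.

Section Oracles.
Context {A : Type} `{Enc A} (i : A -> instance) (Hi : comp total i).

Lemma decid_oracle (e x : A -> nat) (R : A -> nat -> Prop) :
  comp total e -> comp total x -> (forall a, decides (e a) (R a)) ->
  decid (fun a => R a (x a)).
Proof.
  intros He Hx HR. apply (comp_univ _ e x); [assumption ..|].
  intros a _. destruct (HR a (x a)) as [[Ha Hc] | [Ha Hc]].
  - rewrite (proj2 (truth_true _) Ha). exact Hc.
  - rewrite (proj2 (truth_false _) Ha). exact Hc.
Qed.

Lemma comp_language : comp total (fun a =>
  pr (code_bound (sorts (iL (i a)))) (pr (code_bound (rels (iL (i a)))) (i_ty (i a)))).
Proof.
  apply (comp_univ _ (fun a => code (i a)) (fun _ => 0)); [| comp |].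
  - apply comp_encoding. comp.
  - intros a _. apply (i_language (i a)).
Qed.

Lemma comp_structure : comp total (fun a =>
  pr (i_dom (i a)) (pr (i_sort (i a)) (i_rel (i a)))).
Proof.
  apply (comp_univ _ (fun a => code (i a)) (fun _ => 1)); [| comp |].
  - apply comp_encoding. comp.
  - intros a _. apply (i_structure (i a)).
Qed.

Lemma decid_dom (x : A -> nat) :
  comp total x -> decid (fun a => dom (iM (i a)) (x a)).
Proof.
  intros Hx. apply (decid_oracle (fun a => i_dom (i a)) x (fun a => dom (iM (i a))));
    [| assumption |].
  - pose proof comp_structure as S. apply comp_p1 in S.
    eapply comp_ext; [| exact S]. intros a _. symmetry. apply p1_pr.
  - intros a. apply i_dom_spec.
Qed.

Lemma decid_sort (j x : A -> nat) :
  comp total j -> comp total x -> decid (fun a => sort (iM (i a)) (j a) (x a)).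
Proof.
  intros Hj Hx.
  eapply decid_ext; [| apply (decid_oracle (fun a => i_sort (i a))
    (fun a => pr (x a) (j a)) (fun a => coded (fun t => pr (fst t) (snd t))
                      (fun t : nat * nat => sort (iM (i a)) (snd t) (fst t))))].
  - intros a. split.
    + intros Ha. exists (x a, j a). split; [exact Ha | reflexivity].
    + intros [[y k] [Ha E]]. apply pr_inj in E as [-> ->]. exact Ha.
  - pose proof comp_structure as S. apply comp_p2, comp_p1 in S.
    eapply comp_ext; [| exact S]. intros a _. cbn beta. now rewrite p2_pr, p1_pr.
  - comp.
  - intros a. apply i_sort_spec.
Qed.

Lemma decid_rel (k : A -> nat) (bs : A -> list nat) :
  comp total k -> comp total bs -> decid (fun a => rel (iM (i a)) (k a) (bs a)).
Proof.
  intros Hk Hbs.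
  eapply decid_ext; [| apply (decid_oracle (fun a => i_rel (i a))
    (fun a => pr (code (bs a)) (k a)) (fun a => coded (fun t => pr (code_list (fst t)) (snd t))
                      (fun t : list nat * nat => rel (iM (i a)) (snd t) (fst t))))].
  - intros a. split.
    + intros Ha. exists (bs a, k a). split; [exact Ha | now rewrite code_list_code].
    + intros [[y j] [Ha E]]. rewrite code_list_code in E.
      apply pr_inj in E as [E ->]. apply code_inj in E. now rewrite E.
  - pose proof comp_structure as S. apply comp_p2, comp_p2 in S.
    eapply comp_ext; [| exact S]. intros a _. cbn beta. now rewrite !p2_pr.
  - apply comp_encoding in Hbs. comp.
  - intros a. apply i_rel_spec.
Qed.

Lemma decid_below (o : A -> option nat) (j : A -> nat) :
  comp total (fun a => code_bound (o a)) -> comp total j ->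
  decid (fun a => below (o a) (j a)).
Proof.
  intros Ho Hj. apply (decid_bool _
    (fun a => (code_bound (o a) =? 0) || (2 + j a <=? code_bound (o a)))); [comp |].
  intros a. rewrite orb_true_iff, Nat.eqb_eq, Nat.leb_le.
  destruct (o a) as [k |]; simpl; lia.
Qed.

Lemma decid_below_sorts (j : A -> nat) :
  comp total j -> decid (fun a => below (sorts (iL (i a))) (j a)).
Proof.
  apply decid_below. pose proof comp_language as S. apply comp_p1 in S.
  eapply comp_ext; [| exact S]. intros a _. symmetry. apply p1_pr.
Qed.

Lemma decid_below_rels (j : A -> nat) :
  comp total j -> decid (fun a => below (rels (iL (i a))) (j a)).
Proof.
  apply decid_below. pose proof comp_language as S. apply comp_p2, comp_p1 in S.
  eapply comp_ext; [| exact S]. intros a _. cbn beta. now rewrite p2_pr, p1_pr.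
Qed.

Lemma decid_ty (k : A -> nat) (js : A -> list nat) :
  comp total k -> comp total js ->
  decid (fun a => rel_of_type (iL (i a)) (k a) (js a)).
Proof.
  intros Hk Hjs. unfold rel_of_type. apply (decid_bool _ (fun a =>
    if truth (below (rels (iL (i a))) (k a))
    then code (js a) =? code (ty (iL (i a)) (k a)) else false)).
  - apply comp_if; [now apply decid_below_rels | | comp].
    assert (W : forall B (EB : Enc B) (f : A -> B), comp total f -> comp (fun a =>
      total a /\ truth (below (rels (iL (i a))) (k a)) = true) f).
    { intros B EB f. apply comp_weaken. intros a _. exact I. }
    apply comp_eqb; [apply comp_encoding, W, Hjs |].
    apply (comp_univ _ (fun a => i_ty (i a)) k); [| now apply W |].
    + apply W. pose proof comp_language as S. apply comp_p2, comp_p2 in S.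
      eapply comp_ext; [| exact S]. intros a _. cbn beta. now rewrite !p2_pr.
    + intros a [_ Ha]. apply (proj1 (truth_true _)) in Ha.
      pose proof (i_ty_spec (i a) (k a) Ha) as Hc. now rewrite code_list_code in Hc.
  - intros a. destruct (truth _) eqn:E.
    + apply (proj1 (truth_true _)) in E. rewrite Nat.eqb_eq. split.
      * intros [_ ->]. reflexivity.
      * intros Ec. apply code_inj in Ec. auto.
    + apply (proj1 (truth_false _)) in E. split; [tauto | discriminate].
Qed.

End Oracles.

Lemma decid_has_type {A} `{Enc A} (i : A -> instance) (js bs : A -> list nat) :
  comp total i -> comp total js -> comp total bs ->
  decid (fun a => has_type (iM (i a)) (js a) (bs a)).
Proof.
  intros Hi Hj Hb. apply (decid_ext _ (fun a => length (js a) = length (bs a) /\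
    Forall (fun p => sort (iM (i a)) (fst p) (snd p)) (combine (js a) (bs a)))).
  - intros a. unfold has_type. split.
    + induction 1 as [| j b l m Hjb Hlm [IH1 IH2]]; simpl; auto.
    + intros [El Ha]. revert El Ha. generalize (bs a). generalize (js a).
      induction l as [| j l IH]; intros [| b m]; simpl; try discriminate; constructor.
      * now inversion Ha.
      * apply IH; [congruence | now inversion Ha].
  - dec. apply (decid_Forall (fun a p => sort (iM (i a)) (fst p) (snd p))); [| comp].
    apply (decid_sort (fun p : A * (nat * nat) => i (fst p))); [| comp ..].
    apply (comp_app _ i); [assumption | comp].
Qed.

(** * Alternation rank *)

(** The number of alternations of quantifier blocks, Boolean connectives being
    free.  It is at most [n] both on Boolean combinations of Sigma_n formulas
    and on formulas of quantifier rank at most [n]. *)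
Fixpoint rank (f : form) : nat :=
  match f with
  | Fal | Rel _ _ | Eq _ _ => 0
  | Neg f => rank f
  | And f g | Or f g => Nat.max (rank f) (rank g)
  | Ex _ f => if head f =? 6 then rank f else S (rank f)
  | All _ f => if head f =? 7 then rank f else S (rank f)
  end.

Lemma comp_rank {A} `{Enc A} (D : A -> Prop) (f : A -> form) :
  comp D f -> comp D (fun x => rank (f x)).
Proof.
  apply (comp_app D rank).
  set (g := fun x : nat * (form * (nat * nat)) =>
    let f := fst (snd x) in
    let r1 := fst (snd (snd x)) in let r2 := snd (snd (snd x)) in
    if head f <=? 2 then 0 else if head f =? 3 then r1
    else if head f <=? 5 then (if r1 <=? r2 then r2 else r1)
    else if head (arg1 f) =? head f then r1 else S r1).
  assert (R : comp total (fun p : nat * form => rank (snd p))).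
  { apply (comp_form_rec (fun (_ : nat) f => rank f) 0 g); [unfold g; comp |].
    intros k f0. unfold g, on_arg1, on_arg2.
    destruct f0 as [| | | | f1 f2 | f1 f2 | |]; simpl; try reflexivity;
      destruct (Nat.leb_spec (rank f1) (rank f2)); lia. }
  apply (comp_app _ _ (fun f : form => (0, f)) R). comp.
Qed.

Lemma rank_quantifier f : 6 <= head f -> 1 <= rank f.
Proof.
  induction f; simpl; try lia; intros _.
  - destruct (Nat.eqb_spec (head f) 6); [apply IHf |]; lia.
  - destruct (Nat.eqb_spec (head f) 7); [apply IHf |]; lia.
Qed.

Lemma rank_qf f : quantifier_free f -> rank f = 0.
Proof. induction f; simpl; intuition lia. Qed.

Lemma rank_quantifier_rank f : rank f <= quantifier_rank f.
Proof.
  induction f; simpl; try lia.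
  - destruct (head f =? 6); lia.
  - destruct (head f =? 7); lia.
Qed.

(** A Sigma formula of level [n + 1] either begins with an existential quantifier
    or is a Pi formula of level [n]; in the second case one more alternation is
    available for a quantifier put in front. *)
Lemma rank_Sigma_Pi n f :
  (Sigma_form n f -> rank f <= n) /\ (Pi_form n f -> rank f <= n).
Proof.
  revert f. induction n as [| n IH].
  - intros f. split; inversion_clear 1; now rewrite rank_qf.
  - assert (LE : forall f, Sigma_form (S n) f ->
      rank f <= S n /\ (head f <> 6 -> rank f <= n)).
    { intros f. induction f; intros F; inversion_clear F;
        try (match goal with G : Pi_form n _ |- _ => apply IH in G; lia end).
      split; [simpl | now simpl].
      destruct (Nat.eqb_spec (head f) 6); [apply IHf | apply le_n_S, IHf]; assumption. }
    assert (LA : forall f, Pi_form (S n) f ->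
      rank f <= S n /\ (head f <> 7 -> rank f <= n)).
    { intros f. induction f; intros F; inversion_clear F;
        try (match goal with G : Sigma_form n _ |- _ => apply IH in G; lia end).
      split; [simpl | now simpl].
      destruct (Nat.eqb_spec (head f) 7); [apply IHf | apply le_n_S, IHf]; assumption. }
    intros f. split; intros F; [now apply LE | now apply LA].
Qed.

Lemma rank_bool_comb n f : bool_comb (Sigma_form n) f -> rank f <= n.
Proof.
  induction 1 as [f F | | |]; simpl; try lia. exact (proj1 (rank_Sigma_Pi n f) F).
Qed.

(** * Satisfaction *)

Local Notation env := (list ((nat * nat) * nat)).
(** Only assignments that are 0 outside a finite set of variables are needed;
    represented by lists of bindings they have codes. *)
Fixpoint ev (r : env) : var -> nat :=
  match r with
  | [] => fun _ => 0
  | p :: r' => update (ev r') (fst p) (snd p)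
  end.

Lemma assign_ev vs bs : assign vs bs = ev (combine vs bs).
Proof.
  revert bs. induction vs as [| v vs IH]; intros [| b bs]; simpl; try reflexivity.
  now rewrite IH.
Qed.

Lemma comp_var_eqb {A} `{Enc A} (D : A -> Prop) (v w : A -> nat * nat) :
  comp D v -> comp D w -> comp D (fun x => var_eqb (v x) (w x)).
Proof. intros. unfold var_eqb. comp. Qed.

Lemma comp_ev {A} `{Enc A} (D : A -> Prop)
  (r : A -> env) (v : A -> nat * nat) :
  comp D r -> comp D v -> comp D (fun x => ev (r x) (v x)).
Proof.
  intros Hr Hv. apply (comp_app2 D (fun (v : nat * nat) r => ev r v) v r); [| assumption ..].
  apply (comp_list_rec (fun (v : nat * nat) r => ev r v) (fun _ => 0) (fun x =>
    if var_eqb (fst x) (fst (fst (snd x))) then snd (fst (snd x))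
    else snd (snd (snd x)))); try reflexivity; comp.
  apply comp_var_eqb; comp.
Qed.

Definition atomic_sat {L} (M : structure L) (r : var -> nat) (f : form) : Prop :=
  (head f = 1 /\ rel M (rel_symbol f) (map r (rel_vars f))) \/
  (head f = 2 /\ r (fst (eq_vars f)) = r (snd (eq_vars f))).

Section Atomic.
Context {A : Type} `{Enc A} (i : A -> instance) (r : A -> env).
Hypotheses (Hi : comp total i) (Hr : comp total r).

Lemma decid_atomic_sat (f : A -> form) :
  comp total f -> decid (fun a => atomic_sat (iM (i a)) (ev (r a)) (f a)).
Proof.
  intros Hf. unfold atomic_sat. dec.
  - apply (decid_rel i); [assumption | comp |].
    apply (comp_map _ (fun a (v : nat * nat) => ev (r a) v)); [| comp].
    apply (comp_ev total (fun p : A * (nat * nat) => r (fst p))); [| comp].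
    apply (comp_app _ r); [assumption | comp].
  - apply comp_ev; comp.
  - apply comp_ev; comp.
Qed.

End Atomic.

(** ** Boolean combinations, given the truth values of quantified subformulas *)

(** A list [w] of pairs [(b, g)], each claiming that the formula [g] has the
    truth value [b], may force a formula (first component) or its negation
    (second component) to be true.  Only positive occurrences of claims are
    used, so that the value of a formula is established by finitely many correct
    claims and the absence of a claim forces nothing. *)
Fixpoint forced {L} (M : structure L) (r : var -> nat) (w : list (bool * form))
    (f : form) : bool * bool :=
  match f with
  | Fal | Rel _ _ | Eq _ _ => (truth (atomic_sat M r f), negb (truth (atomic_sat M r f)))
  | Neg g => (snd (forced M r w g), fst (forced M r w g))
  | And g h => (fst (forced M r w g) && fst (forced M r w h),
                snd (forced M r w g) || snd (forced M r w h))
  | Or g h => (fst (forced M r w g) || fst (forced M r w h),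
               snd (forced M r w g) && snd (forced M r w h))
  | Ex _ _ | All _ _ => (truth (In (true, f) w), truth (In (false, f) w))
  end.

Definition has_value {L} (M : structure L) (r : var -> nat) (p : bool * form) : Prop :=
  sat M r (snd p) <-> fst p = true.

Lemma atomic_sat_sat {L} (M : structure L) r f :
  head f <= 2 -> atomic_sat M r f <-> sat M r f.
Proof.
  unfold atomic_sat. destruct f; simpl; intros Hh; try lia;
    intuition (try discriminate).
Qed.

Lemma forced_sound {L} (M : structure L) r w f :
  Forall (has_value M r) w ->
  (fst (forced M r w f) = true -> sat M r f) /\
  (snd (forced M r w f) = true -> ~ sat M r f).
Proof.
  intros Hw. rewrite Forall_forall in Hw. unfold has_value in Hw. induction f;
    simpl; rewrite ?negb_true_iff, ?truth_false, ?truth_true, ?andb_true_iff, ?orb_true_iff;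
    try (rewrite atomic_sat_sat by (simpl; lia); simpl); try tauto.
  - split; intros Hv; apply Hw in Hv; simpl in Hv; intuition discriminate.
  - split; intros Hv; apply Hw in Hv; simpl in Hv; intuition discriminate.
Qed.

Lemma forced_mono {L} (M : structure L) r w w' f :
  incl w w' ->
  (fst (forced M r w f) = true -> fst (forced M r w' f) = true) /\
  (snd (forced M r w f) = true -> snd (forced M r w' f) = true).
Proof.
  intros Hw. induction f; simpl;
    rewrite ?truth_true, ?andb_true_iff, ?orb_true_iff; try tauto; auto.
Qed.

(** [Lit] is any supply of correct claims that has one about each quantified
    subformula of [f]. *)
Lemma forced_complete {L} (M : structure L) r (Lit : bool * form -> Prop) n f :
  (forall b g, 6 <= head g -> rank g <= n -> has_value M r (b, g) -> Lit (b, g)) ->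
  rank f <= n ->
  exists w, Forall Lit w /\
    (sat M r f -> fst (forced M r w f) = true) /\
    (~ sat M r f -> snd (forced M r w f) = true).
Proof.
  intros HL. unfold has_value in HL. induction f; intros Hn.
  1-3: exists []; split; [constructor |]; simpl;
    rewrite negb_true_iff, truth_false, truth_true, atomic_sat_sat by (simpl; lia); simpl; tauto.
  - destruct (IHf Hn) as (w & Hw & H1 & H2). exists w. simpl.
    split; [assumption |]. split; [assumption |]. intros N. apply H1, NNPP, N.
  - simpl in Hn. destruct IHf1 as (w1 & Hw1 & H1 & H2); [lia |].
    destruct IHf2 as (w2 & Hw2 & H3 & H4); [lia |].
    exists (w1 ++ w2). split; [now apply Forall_app |]. simpl.
    destruct (forced_mono M r w1 (w1 ++ w2) f1) as [M1 M2]; [apply incl_appl, incl_refl |].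
    destruct (forced_mono M r w2 (w1 ++ w2) f2) as [M3 M4]; [apply incl_appr, incl_refl |].
    rewrite andb_true_iff, orb_true_iff.
    destruct (classic (sat M r f1)), (classic (sat M r f2)); tauto.
  - simpl in Hn. destruct IHf1 as (w1 & Hw1 & H1 & H2); [lia |].
    destruct IHf2 as (w2 & Hw2 & H3 & H4); [lia |].
    exists (w1 ++ w2). split; [now apply Forall_app |]. simpl.
    destruct (forced_mono M r w1 (w1 ++ w2) f1) as [M1 M2]; [apply incl_appl, incl_refl |].
    destruct (forced_mono M r w2 (w1 ++ w2) f2) as [M3 M4]; [apply incl_appr, incl_refl |].
    rewrite andb_true_iff, orb_true_iff.
    destruct (classic (sat M r f1)), (classic (sat M r f2)); tauto.
  - exists [(truth (sat M r (Ex v f)), Ex v f)]. split.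
    + constructor; [| constructor]. apply HL; [simpl; lia | assumption |].
      cbn [fst snd]. now rewrite truth_true.
    + cbn [forced fst snd]. rewrite !truth_true. split; intros Hs; left; f_equal;
        [now apply truth_true | now apply truth_false].
  - exists [(truth (sat M r (All v f)), All v f)]. split.
    + constructor; [| constructor]. apply HL; [simpl; lia | assumption |].
      cbn [fst snd]. now rewrite truth_true.
    + cbn [forced fst snd]. rewrite !truth_true. split; intros Hs; left; f_equal;
        [now apply truth_true | now apply truth_false].
Qed.

Lemma comp_forced {A} `{Enc A} (i : A -> instance)
  (r : A -> env) (w : A -> list (bool * form)) (f : A -> form) :
  comp total i -> comp total r -> comp total w -> comp total f ->
  comp total (fun a => forced (iM (i a)) (ev (r a)) (w a) (f a)).
Proof.
  intros Hi Hr Hw Hf.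
  apply (comp_app2 total (fun a => forced (iM (i a)) (ev (r a)) (w a)) (fun a => a) f);
    [| comp | assumption].
  set (at_ := fun x : A * (form * ((bool * bool) * (bool * bool))) =>
    truth (atomic_sat (iM (i (fst x))) (ev (r (fst x))) (fst (snd x)))).
  set (lit := fun b (x : A * (form * ((bool * bool) * (bool * bool)))) =>
    truth (In (b, fst (snd x)) (w (fst x)))).
  set (g := fun x : A * (form * ((bool * bool) * (bool * bool))) =>
    let f := fst (snd x) in
    let r1 := fst (snd (snd x)) in let r2 := snd (snd (snd x)) in
    if head f <=? 2 then (at_ x, negb (at_ x))
    else if head f =? 3 then (snd r1, fst r1)
    else if head f =? 4 then (fst r1 && fst r2, snd r1 || snd r2)
    else if head f =? 5 then (fst r1 || fst r2, snd r1 && snd r2)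
    else (lit true x, lit false x)).
  apply (comp_form_rec (fun a => forced (iM (i a)) (ev (r a)) (w a)) (false, false) g).
  - assert (Hat : comp total at_).
    { apply (decid_atomic_sat (fun x : A * (form * ((bool * bool) * (bool * bool))) => i (fst x))
        (fun x => r (fst x))); [| | comp].
      - apply (comp_app _ i); [assumption | comp].
      - apply (comp_app _ r); [assumption | comp]. }
    assert (Hlit : forall b, comp total (lit b)).
    { intros b. apply (decid_In (fun x : A * (form * ((bool * bool) * (bool * bool))) =>
        (b, fst (snd x))) (fun x => w (fst x))); [comp |].
      apply (comp_app _ w); [assumption | comp]. }
    pose proof (Hlit true). pose proof (Hlit false). unfold g. cbv zeta. comp.
  - intros a f0. unfold g, at_, lit, on_arg1, on_arg2. destruct f0; reflexivity.
Qed.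

(** ** Quantifier blocks *)

(** Strips one quantifier, of the kind selected by [q], and binds its variable
    to [a].  The flag in the state tells whether this has been possible up to
    now, which makes a total function of it that can be iterated along a list of
    witnesses. *)
Definition peel1 {L} (M : structure L) (q : bool)
    (s : bool * (form * env)) (a : nat) :=
  let f := fst (snd s) in
  if truth (fst s = true /\ head f = (if q then 6 else 7) /\
          sort M (fst (bound_var f)) a)
  then (true, (arg1 f, (bound_var f, a) :: snd (snd s)))
  else (false, snd s).

Definition peel {L} (M : structure L) (q : bool) (s : bool * (form * env)) (l : list nat) :=
  fold_left (peel1 M q) l s.

Lemma peel_false {L} (M : structure L) q p l : fst (peel M q (false, p) l) = false.
Proof.
  revert p. induction l as [| a l IH]; intros p; [reflexivity |].
  unfold peel in *. cbn [fold_left]. unfold peel1 at 2. destruct (truth _) eqn:E.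
  - apply (proj1 (truth_true _)) in E. destruct E as [E _]. discriminate.
  - apply IH.
Qed.

(** A peeled formula gets from its kernel the truth value that witnesses can
    establish: true for existential and false for universal blocks. *)
Lemma peel_sound {L} (M : structure L) (q : bool) l f r :
  let s := peel M q (true, (f, r)) l in
  fst s = true -> has_value M (ev (snd (snd s))) (q, fst (snd s)) ->
  has_value M (ev r) (q, f).
Proof.
  revert f r. induction l as [| a l IH]; intros f r s; subst s; [now simpl |].
  unfold peel in *. cbn [fold_left]. unfold peel1 at 2 4 6. cbn [fst snd].
  destruct (truth _) eqn:E.
  - apply (proj1 (truth_true _)) in E. destruct E as (_ & Hh & Ha). intros H1 H2.
    specialize (IH _ _ H1 H2). unfold has_value in *. cbn [fst snd] in *.
    destruct q, f; try discriminate; cbn [arg1 bound_var fst sat] in *.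
    + split; [reflexivity |]. intros _. exists a. split; [assumption |]. now apply IH.
    + split; [| discriminate]. intros HA. apply IH, HA, Ha.
  - intros H1. pose proof (peel_false M q (f, r) l) as H2. unfold peel in H2. congruence.
Qed.

(** Peeling can go on until the rank drops, which happens exactly at the end of
    the leading block. *)
Lemma peel_complete {L} (M : structure L) (q : bool) n f r :
  rank f <= S n -> head f = (if q then 6 else 7) \/ rank f <= n ->
  has_value M (ev r) (q, f) ->
  exists l, let s := peel M q (true, (f, r)) l in
    fst s = true /\ rank (fst (snd s)) <= n /\
    has_value M (ev (snd (snd s))) (q, fst (snd s)).
Proof.
  revert r. induction f as [f IH] using (well_founded_induction (well_founded_ltof _ form_size)).
  intros r Hr Hh Hv. destruct (Nat.le_gt_cases (rank f) n) as [Hn | Hn].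
  { exists []. simpl. auto. }
  destruct Hh as [Hh | Hh]; [| lia].
  assert (Hs : form_size (arg1 f) < form_size f) by (destruct q, f; simpl in *; lia).
  assert (Hg : rank (arg1 f) <= S n /\
    (head (arg1 f) = (if q then 6 else 7) \/ rank (arg1 f) <= n)).
  { destruct q, f as [| | | | | | v f | v f]; try discriminate; cbn [rank arg1] in *.
    - destruct (Nat.eqb_spec (head f) 6); lia.
    - destruct (Nat.eqb_spec (head f) 7); lia. }
  assert (Ha : exists a, sort M (fst (bound_var f)) a /\
            has_value M (ev ((bound_var f, a) :: r)) (q, arg1 f)).
  { unfold has_value in *. cbn [fst snd] in *.
    destruct q, f as [| | | | | | v f | v f]; try discriminate;
      cbn [arg1 bound_var sat ev fst snd] in *.
    - destruct (proj2 Hv eq_refl) as [a [Ha Hf]]. exists a. split; [assumption |]. tauto.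
    - destruct (not_all_ex_not _ _ (fun HA => diff_false_true (proj1 Hv HA))) as [a Na].
      apply imply_to_and in Na as [Ha Nf]. exists a. split; [assumption |].
      split; [tauto | discriminate]. }
  destruct Ha as [a [Ha Hf]].
  destruct (IH (arg1 f) Hs _ (proj1 Hg) (proj2 Hg) Hf) as [l Hl].
  assert (E1 : peel1 M q (true, (f, r)) a = (true, (arg1 f, (bound_var f, a) :: r))).
  { unfold peel1. cbn [fst snd]. rewrite (proj2 (truth_true _)) by auto. reflexivity. }
  exists (a :: l). unfold peel in *. cbn [fold_left]. rewrite E1. exact Hl.
Qed.

Lemma comp_peel {A} `{Enc A} (i : A -> instance) (q : A -> bool)
  (s : A -> bool * (form * env)) (l : A -> list nat) :
  comp total i -> comp total q -> comp total s -> comp total l ->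
  comp total (fun a => peel (iM (i a)) (q a) (s a) (l a)).
Proof.
  intros Hi Hq Hs Hl. unfold peel.
  apply (comp_fold_left total (fun a => peel1 (iM (i a)) (q a))); [| assumption ..].
  unfold peel1. cbv zeta. apply comp_ite; [| comp | comp].
  match goal with |- comp total (fun x => truth (@?R x)) => change (decid R) end.
  assert (Hq' : comp total (fun x : A * (bool * (form * env) * nat) =>
    q (fst x))) by (apply (comp_app _ q); [assumption | comp]).
  dec. apply (decid_sort (fun x : A * (bool * (form * env) * nat) =>
    i (fst x))); [| comp ..].
  apply (comp_app _ i); [assumption | comp].
Qed.

(** ** The complexity of satisfaction *)

Local Notation claim := (instance * (env * (bool * form)))%type.

Definition claim_holds (x : claim) : Prop :=
  has_value (iM (fst x)) (ev (fst (snd x))) (snd (snd x)).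

(** If the claims about quantified formulas are Sigma_k, for some positive k,
    then so are all claims: a list of correct claims that forces the claim in
    question is searched for, and its correctness is a conjunction over a list. *)
Lemma arith_boolean k n (Lit : claim -> Prop) :
  arith true (S k) Lit ->
  (forall x, Lit x -> claim_holds x) ->
  (forall i r b g, 6 <= head g -> rank g <= n -> claim_holds (i, (r, (b, g))) ->
     Lit (i, (r, (b, g)))) ->
  arith true (S k) (fun x : claim => rank (snd (snd (snd x))) <= n /\ claim_holds x).
Proof.
  intros HL Hs Hc.
  apply (arith_ext _ _ _ (fun x : claim => rank (snd (snd (snd x))) <= n /\
    exists w, Forall (fun p => Lit (fst x, (fst (snd x), p))) w /\
      (if fst (snd (snd x))
       then fst (forced (iM (fst x)) (ev (fst (snd x))) w (snd (snd (snd x))))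
       else snd (forced (iM (fst x)) (ev (fst (snd x))) w (snd (snd (snd x))))) = true)).
  - intros [i [r [b f]]]. cbn [fst snd]. unfold claim_holds, has_value at 1. cbn [fst snd].
    split; intros [Hn Hx]; (split; [assumption |]).
    + destruct (forced_complete (iM i) (ev r) (fun p => Lit (i, (r, p))) n f)
        as (w & Hw & H1 & H2); [| assumption |].
      { intros b' g H6 Hg Hv. now apply Hc. }
      exists w. split; [assumption |]. destruct b.
      * apply H1, Hx. reflexivity.
      * apply H2. intros Hf. apply Hx in Hf. discriminate.
    + destruct Hx as (w & Hw & Hf).
      destruct (forced_sound (iM i) (ev r) w f) as [S1 S2].
      { eapply Forall_impl; [| exact Hw]. intros p Hp. apply (Hs _ Hp). }
      destruct b.
      * split; [reflexivity |]. intros _. apply S1, Hf.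
      * split; [| discriminate]. intros Hx. elim (S2 Hf Hx).
  - apply arith_and.
    { apply arith_decid, decid_le; [| comp]. apply comp_rank. comp. }
    apply (arith_exists k (fun (x : claim) w =>
      Forall (fun p => Lit (fst x, (fst (snd x), p))) w /\ _)).
    apply arith_and.
    + apply (arith_app _ _
        (fun y : instance * env * list (bool * form) =>
           Forall (fun p => Lit (fst (fst y), (snd (fst y), p))) (snd y))
        (fun y : claim * list (bool * form) =>
           (fst (fst y), fst (snd (fst y)), snd y))); [| comp].
      apply (arith_Forall _ _
        (fun (z : instance * env) p => Lit (fst z, (snd z, p)))).
      apply (arith_app _ _ Lit (fun z : instance * env * (bool * form) =>
        (fst (fst z), (snd (fst z), snd z)))); [assumption | comp].
    + apply arith_decid, decid_is_true.
      assert (Hf := comp_forced (fun y : claim * list (bool * form) => fst (fst y))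
        (fun y => fst (snd (fst y))) (fun y => snd y) (fun y => snd (snd (snd (fst y))))
        ltac:(comp) ltac:(comp) ltac:(comp) ltac:(comp)).
      comp.
Qed.

(** By induction on the rank.  A block takes the truth value that witnesses can
    establish if and only if some tuple of witnesses leads to a kernel, of
    smaller rank, that takes this value; this is Sigma_(n+1) for blocks of rank
    [n + 1].  The opposite truth value is Pi_(n+1), and so either claim about a
    block is Sigma_(n+2). *)
Lemma arith_sat n :
  arith true (S n) (fun x : claim => rank (snd (snd (snd x))) <= n /\ claim_holds x).
Proof.
  induction n as [| n IH].
  - apply (arith_boolean 0 0 (fun _ => False)).
    + apply arith_decid, decid_const.
    + tauto.
    + intros i r b g H6 H0. apply rank_quantifier in H6. lia.
  - (* The claim that a block has the truth value that a witness tuple for its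
       leading quantifier establishes. *)
    set (kind := fun x : claim => head (snd (snd (snd x))) =? 6).
    set (state := fun (x : claim) l =>
      peel (iM (fst x)) (kind x) (true, (snd (snd (snd x)), fst (snd x))) l).
    set (block := fun x : claim => exists l, fst (state x l) = true /\
      rank (fst (snd (state x l))) <= n /\
      claim_holds (fst x, (snd (snd (state x l)), (kind x, fst (snd (state x l)))))).
    assert (Hkind : comp total kind) by (unfold kind; comp).
    assert (Hblock : arith true (S n) block).
    { apply (arith_exists n (fun x l => fst (state x l) = true /\ _)).
      assert (Hstate : comp total (fun p : claim * list nat => state (fst p) (snd p))).
      { apply (comp_peel (fun p : claim * list nat => fst (fst p))
                 (fun p => kind (fst p))); [comp | | comp | comp].
        apply (comp_app _ kind); [assumption | comp]. }
      apply arith_and; [apply arith_decid; dec |].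
      apply (arith_app _ _ (fun x : claim => rank (snd (snd (snd x))) <= n /\ claim_holds x)
        (fun p : claim * list nat => (fst (fst p), (snd (snd (state (fst p) (snd p))),
           (kind (fst p), fst (snd (state (fst p) (snd p)))))))); [exact IH |].
      assert (comp total (fun p : claim * list nat => kind (fst p)))
        by (apply (comp_app _ kind); [assumption | comp]).
      comp. }
    assert (Eblock : forall x, 6 <= head (snd (snd (snd x))) ->
      rank (snd (snd (snd x))) <= S n ->
      (block x <-> claim_holds (fst x, (fst (snd x), (kind x, snd (snd (snd x))))))).
    { intros [i [r [b f]]] H6 Hn. cbn [fst snd] in *. split.
      - intros (l & H1 & _ & H2). exact (peel_sound (iM i) _ l f r H1 H2).
      - intros Hv. apply (peel_complete (iM i) _ n f r); [assumption | | exact Hv].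
        left. unfold kind. cbn [fst snd]. destruct f; simpl in *; lia. }
    apply (arith_boolean (S n) (S n) (fun x : claim =>
      6 <= head (snd (snd (snd x))) /\ rank (snd (snd (snd x))) <= S n /\
      ((fst (snd (snd x)) = kind x /\ block x) \/
       (~ fst (snd (snd x)) = kind x /\ ~ block x)))).
    + apply arith_and; [apply arith_decid, decid_le; comp |].
      apply arith_and; [apply arith_decid, decid_le; [apply comp_rank |]; comp |].
      apply arith_or; apply arith_and.
      * apply arith_decid. dec.
      * apply (arith_succ true), Hblock.
      * apply arith_decid. dec.
      * apply (arith_succ false), (arith_not true), Hblock.
    + intros x (H6 & Hn & Hx). rewrite (Eblock x H6 Hn) in Hx.
      unfold claim_holds, has_value in *. cbn [fst snd] in *.
      destruct (classic (sat (iM (fst x)) (ev (fst (snd x))) (snd (snd (snd x))))),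
        (fst (snd (snd x))), (kind x); intuition congruence.
    + intros i r b g H6 Hn Hx. split; [assumption |]. split; [assumption |].
      rewrite Eblock by assumption.
      unfold claim_holds, has_value in *. cbn [fst snd] in *.
      destruct (classic (sat (iM i) (ev r) g)), b, (kind (i, (r, (_, g))));
        intuition congruence.
Qed.

(** * Syntactic conditions *)

Lemma decid_wf {A} `{Enc A} (i : A -> instance) (f : A -> form) :
  comp total i -> comp total f -> decid (fun a => wf (iL (i a)) (f a)).
Proof.
  intros Hi Hf.
  apply (decid_app (fun p : instance * form => wf (iL (fst p)) (snd p))
           (fun a => (i a, f a))); [| comp].
  set (G := fun x : instance * (form * (bool * bool)) =>
    let L := iL (fst x) in let f := fst (snd x) in
    head f = 0 \/
    (head f = 1 /\ rel_of_type L (rel_symbol f) (map fst (rel_vars f))) \/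
    (head f = 2 /\ below (sorts L) (fst (fst (eq_vars f))) /\
       fst (fst (eq_vars f)) = fst (snd (eq_vars f))) \/
    (fst (snd (snd x)) = true /\
       ((head f =? 4) || (head f =? 5) = true -> snd (snd (snd x)) = true) /\
       ((6 <=? head f) = true -> below (sorts L) (fst (bound_var f))))).
  apply (decid_form_rec (fun i f => wf (iL i) f) G).
  - unfold G. cbv zeta. dec.
    + apply (decid_ty (fun x : instance * (form * (bool * bool)) => fst x)); [comp | comp |].
      apply (comp_map _ (fun _ (v : nat * nat) => fst v)); comp.
    + apply (decid_below_sorts (fun x : instance * (form * (bool * bool)) => fst x)); comp.
    + apply (decid_below_sorts (fun x : instance * (form * (bool * bool)) => fst x)); comp.
  - intros j g. unfold G, rel_of_type, var_sort, on_arg1, on_arg2.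
    destruct g; cbn; rewrite ?truth_true; intuition (congruence || discriminate).
Qed.

Lemma decid_free {A} `{Enc A} (v : A -> nat * nat) (f : A -> form) :
  comp total v -> comp total f -> decid (fun a => free (v a) (f a)).
Proof.
  intros Hv Hf.
  apply (decid_app (fun p : (nat * nat) * form => free (fst p) (snd p))
           (fun a => (v a, f a))); [| comp].
  set (G := fun x : (nat * nat) * (form * (bool * bool)) =>
    let f := fst (snd x) in
    In (fst x) (rel_vars f) \/
    (head f = 2 /\ (fst x = fst (eq_vars f) \/ fst x = snd (eq_vars f))) \/
    (fst (snd (snd x)) = true /\ ((6 <=? head f) = true -> ~ fst x = bound_var f)) \/
    snd (snd (snd x)) = true).
  apply (decid_form_rec (fun (v : nat * nat) f => free v f) G).
  - unfold G. cbv zeta. dec.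
  - intros w g. unfold G, rel_of_type, var_sort, on_arg1, on_arg2.
    destruct g; cbn; rewrite ?truth_true; intuition (congruence || discriminate).
Qed.

Lemma decid_NoDup {A E} `{Enc A} `{Dec E} (l : A -> list E) :
  comp total l -> decid (fun a => NoDup (l a)).
Proof.
  intros Hl.
  apply (decid_app (fun p : nat * list E => NoDup (snd p)) (fun a => (0, l a))); [| comp].
  apply (decid_list_rec (fun (_ : nat) l => NoDup l) (fun _ => True) (fun x =>
    ~ In (fst (snd x)) (fst (snd (snd x))) /\ snd (snd (snd x)) = true)).
  - apply decid_const.
  - dec.
  - intros k. split; constructor.
  - intros k e m. cbn [fst snd]. rewrite truth_true, NoDup_cons_iff. reflexivity.
Qed.

Lemma decid_quantifier_free : decid quantifier_free.
Proof.
  apply (decid_form_rec0 _ (fun x => (head (fst x) <=? 5) = true /\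
    ((3 <=? head (fst x)) = true -> fst (snd x) = true) /\
    ((4 <=? head (fst x)) = true -> snd (snd x) = true))).
  - dec.
  - intros f. unfold on_arg1, on_arg2.
    destruct f; cbn; rewrite ?truth_true; intuition (discriminate || idtac).
Qed.

Lemma decid_Sigma_Pi n : decid (Sigma_form n) /\ decid (Pi_form n).
Proof.
  induction n as [| n [IHS IHP]]; split.
  - eapply decid_ext; [| apply decid_quantifier_free].
    intros f. split; [now inversion 1 | now constructor].
  - eapply decid_ext; [| apply decid_quantifier_free].
    intros f. split; [now inversion 1 | now constructor].
  - apply (decid_form_rec0 _ (fun x => Pi_form n (fst x) \/
      (head (fst x) = 6 /\ fst (snd x) = true))).
    + dec. apply (decid_app (Pi_form n)); [assumption | comp].
    + intros f. unfold on_arg1. split.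
      * inversion 1; subst; [now left | right]. simpl. now rewrite truth_true.
      * intros [F | [Hh F]]; [now constructor |].
        destruct f; try discriminate. simpl in F. rewrite truth_true in F.
        now apply Sigma_Ex.
  - apply (decid_form_rec0 _ (fun x => Sigma_form n (fst x) \/
      (head (fst x) = 7 /\ fst (snd x) = true))).
    + dec. apply (decid_app (Sigma_form n)); [assumption | comp].
    + intros f. unfold on_arg1. split.
      * inversion 1; subst; [now left | right]. simpl. now rewrite truth_true.
      * intros [F | [Hh F]]; [now constructor |].
        destruct f; try discriminate. simpl in F. rewrite truth_true in F.
        now apply Pi_All.
Qed.

Lemma decid_bool_comb (P : form -> Prop) : decid P -> decid (bool_comb P).
Proof.
  intros HP. apply (decid_form_rec0 _ (fun x => P (fst x) \/
    (3 <= head (fst x) /\ head (fst x) <= 5 /\ fst (snd x) = true /\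
     (4 <= head (fst x) -> snd (snd x) = true)))).
  - dec. apply (decid_app P); [assumption | comp].
  - intros f. unfold on_arg1, on_arg2. split.
    + destruct 1 as [f F | f F | f g F G | f g F G]; [now left | right ..];
        cbn; rewrite !truth_true; intuition lia.
    + intros [F | (H3 & H5 & F & G)]; [now constructor |].
      destruct f; cbn in *; try lia; rewrite truth_true in F.
      * now apply bc_neg.
      * specialize (G ltac:(lia)). rewrite truth_true in G. now apply bc_and.
      * specialize (G ltac:(lia)). rewrite truth_true in G. now apply bc_or.
Qed.

Lemma arith_pwf b k :
  arith b (2 + k) (fun x : instance * pform => pwf (iL (fst x)) (snd x)).
Proof.
  unfold pwf. apply arith_and; [apply arith_decid | apply arith_and; [apply arith_decid |]].
  - apply decid_wf; comp.
  - apply (decid_NoDup (fun x : instance * pform => pxs (snd x) ++ pys (snd x) : list (nat * nat))).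
    comp.
  - apply (arith_le b 2); [lia |]. apply (arith_succ false).
    apply (arith_forall 0 (fun (x : instance * pform) (v : nat * nat) =>
      free v (body (snd x)) <-> In v (pxs (snd x) ++ pys (snd x)))).
    apply arith_decid, decid_iff.
    + apply decid_free; comp.
    + apply (decid_In (fun p : instance * pform * (nat * nat) => snd p)
        (fun p => pxs (snd (fst p)) ++ pys (snd (fst p)) : list (nat * nat))); comp.
Qed.

(** * Algebraic and definable closure of formulas *)

Lemma decid_tuple_type {A} `{Enc A} (i : A -> instance)
  (vs : A -> list (nat * nat)) (bs : A -> list nat) :
  comp total i -> comp total vs -> comp total bs ->
  decid (fun a => has_type (iM (i a)) (map var_sort (vs a)) (bs a)).
Proof.
  intros Hi Hv Hb. apply (decid_has_type i); try assumption.
  apply (comp_map total (fun _ (v : nat * nat) => fst v)); [comp | assumption].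
Qed.

(** Satisfaction is Pi_(n+1) as well, because the claim that a formula is false
    is Sigma_(n+1) by the same lemma as the claim that it is true. *)
Lemma arith_holds b n {A} `{Enc A} (i : A -> instance) (p : A -> pform)
  (xs ys : A -> list nat) :
  comp total i -> comp total p -> comp total xs -> comp total ys ->
  arith b (S n) (fun a => rank (body (p a)) <= n /\ holds (iM (i a)) (p a) (xs a) (ys a)).
Proof.
  intros Hi Hp Hxs Hys.
  set (cl := fun c a => (i a, (combine (pxs (p a) ++ pys (p a)) (xs a ++ ys a),
                                (c, body (p a)))) :
    instance * (env * (bool * form))).
  assert (Hcl : forall c, comp total (cl c)).
  { intros c. unfold cl. comp. }
  assert (HR : forall c, arith true (S n) (fun a => rank (body (p a)) <= n /\
    claim_holds (cl c a))).
  { intros c. apply (arith_app _ _ _ (cl c) (arith_sat n)), Hcl. }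
  assert (E : forall c a, claim_holds (cl c a) <->
    (sat (iM (i a)) (assign (pxs (p a) ++ pys (p a)) (xs a ++ ys a)) (body (p a))
      <-> c = true)).
  { intros c a. rewrite assign_ev. reflexivity. }
  set (typed := fun a => rank (body (p a)) <= n /\
    has_type (iM (i a)) (map var_sort (pxs (p a))) (xs a) /\
    has_type (iM (i a)) (map var_sort (pys (p a))) (ys a)).
  assert (Ht : decid typed).
  { unfold typed. repeat apply decid_and.
    - apply decid_le; [apply comp_rank |]; comp.
    - apply decid_tuple_type; comp.
    - apply decid_tuple_type; comp. }
  destruct b.
  - apply (arith_ext _ _ _ (fun a => typed a /\
      rank (body (p a)) <= n /\ claim_holds (cl true a))).
    + intros a. rewrite E. unfold typed, holds. tauto.
    + apply arith_and; [now apply arith_decid | apply HR].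
  - apply (arith_ext _ _ _ (fun a => typed a /\
      ~ (rank (body (p a)) <= n /\ claim_holds (cl false a)))).
    + intros a. rewrite E. unfold typed, holds.
      destruct (classic (sat (iM (i a)) (assign (pxs (p a) ++ pys (p a)) (xs a ++ ys a))
        (body (p a)))); intuition congruence.
    + apply arith_and; [now apply arith_decid | apply (arith_not true), HR].
Qed.

Lemma ensemble_ext {T} (X Y : T -> Prop) : (forall t, X t <-> Y t) -> X = Y.
Proof. intros E. extensionality t. apply propositional_extensionality, E. Qed.

(** This puts finiteness in the form of an existential quantifier over lists and
    a universal quantifier over elements. *)
Lemma finite_listed {T} (X : T -> Prop) :
  Finite T X <-> exists l, forall t, X t -> In t l.
Proof.
  split.
  - induction 1 as [| X HX [l Hl] t Ht].
    + exists []. intros t [].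
    + exists (t :: l). intros s [s' Hs | s' []]; [right; now apply Hl | now left].
  - intros [l Hl]. revert X Hl. induction l as [| t l IH]; intros X Hl.
    + rewrite (ensemble_ext X (Empty_set T)); [constructor |].
      intros t. split; [intros Ht; elim (Hl t Ht) | intros []].
    + destruct (classic (X t)) as [Ht | Ht].
      * rewrite (ensemble_ext X (Ensembles.Add T (fun s => X s /\ s <> t) t)).
        -- apply Union_is_finite.
           ++ apply IH. intros s [Hs Ns]. destruct (Hl s Hs); [now elim Ns | assumption].
           ++ intros [_ N]. now apply N.
        -- intros s. split.
           ++ intros Hs. destruct (classic (s = t)) as [-> | N];
                [right; constructor | left; now split].
           ++ intros [s' [Hs _] | s' []]; assumption.
      * apply IH. intros s Hs. destruct (Hl s Hs) as [-> | Hi]; [contradiction | assumption].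
Qed.

Lemma card_in_finite {T} (X : T -> Prop) :
  card_in X (fun k => k <> None) <-> Finite T X.
Proof.
  split.
  - intros [(k & Hk & _) | (_ & N)]; [| now elim N].
    clear -Hk. induction Hk; constructor; assumption.
  - intros HX. left. enough (exists k, cardinal T X k) as [k Hk] by (exists k; now split).
    induction HX as [| X HX [k Hk] t Ht].
    + exists 0. constructor.
    + exists (S k). now constructor.
Qed.

Lemma card_in_one {T} (X : T -> Prop) :
  card_in X (fun k => k = Some 1) <-> exists! t, X t.
Proof.
  split.
  - intros [(k & Hk & E) | (_ & E)]; [| discriminate]. injection E as ->.
    inversion Hk as [| A n HA t Ht EA]; subst. inversion HA; subst.
    exists t. split; [right; constructor |]. intros s [s' [] | s' []]. reflexivity.
  - intros [t [Ht Hu]]. left. exists 1. split; [| reflexivity].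
    rewrite (ensemble_ext X (Ensembles.Add T (Empty_set T) t)).
    + constructor; [constructor | intros []].
    + intros s. split.
      * intros Hs. rewrite <- (Hu s Hs). right. constructor.
      * intros [s' [] | s' []]. assumption.
Qed.

Section Cardinality.
Context {A : Type} `{Enc A} (n : nat) (i : A -> instance) (p : A -> pform)
  (xs : A -> list nat).
Hypotheses (Hi : comp total i) (Hp : comp total p) (Hxs : comp total xs).

Let solutions (a : A) (ys : list nat) : Prop :=
  rank (body (p a)) <= n /\ holds (iM (i a)) (p a) (xs a) ys.

Lemma arith_finite :
  arith true (S (S n)) (fun a => Finite (list nat) (solutions a)).
Proof using Hi Hp Hxs.
  apply (arith_ext _ _ _ (fun a => exists l, forall ys, solutions a ys -> In ys l)).
  { intros a. apply finite_listed. }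
  apply (arith_exists (S n) (fun a l => forall ys, solutions a ys -> In ys l)).
  apply (arith_succ false).
  apply (arith_forall n (fun (q : A * list (list nat)) ys =>
    solutions (fst q) ys -> In ys (snd q))).
  apply arith_imp.
  - apply (arith_holds true n (fun z : A * list (list nat) * list nat => i (fst (fst z)))
      (fun z => p (fst (fst z))) (fun z => xs (fst (fst z))) (fun z => snd z)); [.. | comp].
    + apply (comp_app _ i); [assumption | comp].
    + apply (comp_app _ p); [assumption | comp].
    + apply (comp_app _ xs); [assumption | comp].
  - apply arith_decid, (decid_In (fun z : A * list (list nat) * list nat => snd z)
      (fun z => snd (fst z))); comp.
Qed.

(** Existence is Sigma_(n+1) and uniqueness is Pi_(n+1), whence their conjunction
    is both Sigma_(n+2) and Pi_(n+2). *)
Lemma arith_unique b :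
  arith b (S (S n)) (fun a => exists! ys, solutions a ys).
Proof using Hi Hp Hxs.
  apply (arith_ext _ _ _ (fun a => (exists ys, solutions a ys) /\
    forall q : list nat * list nat, solutions a (fst q) -> solutions a (snd q) ->
      fst q = snd q)).
  { intros a. split.
    - intros [ys [Hys Hu]]. split; [now exists ys |].
      intros [y z] Hy Hz. cbn [fst snd] in *. now rewrite <- (Hu y Hy), <- (Hu z Hz).
    - intros [[ys Hys] Hu]. exists ys. split; [assumption |].
      intros zs Hzs. exact (Hu (ys, zs) Hys Hzs). }
  apply arith_and.
  - apply (arith_succ true). apply (arith_exists n solutions).
    apply (arith_holds true n (fun z : A * list nat => i (fst z))
      (fun z => p (fst z)) (fun z => xs (fst z)) (fun z => snd z)); [.. | comp].
    + apply (comp_app _ i); [assumption | comp].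
    + apply (comp_app _ p); [assumption | comp].
    + apply (comp_app _ xs); [assumption | comp].
  - apply (arith_succ false). apply (arith_forall n (fun a (q : list nat * list nat) =>
      solutions a (fst q) -> solutions a (snd q) -> fst q = snd q)).
    assert (HS : forall c (z : A * (list nat * list nat) -> list nat), comp total z ->
      arith c (S n) (fun x => solutions (fst x) (z x))).
    { intros c z Hz.
      apply (arith_holds c n (fun x : A * (list nat * list nat) => i (fst x))
        (fun x => p (fst x)) (fun x => xs (fst x)) z); [.. | assumption].
      - apply (comp_app _ i); [assumption | comp].
      - apply (comp_app _ p); [assumption | comp].
      - apply (comp_app _ xs); [assumption | comp]. }
    apply arith_imp; [apply HS; comp |]. apply arith_imp; [apply HS; comp |].
    apply arith_decid.
    apply (decid_eq (fun x : A * (list nat * list nat) => fst (snd x))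
      (fun x => snd (snd x))); comp.
Qed.

End Cardinality.

Local Notation query := (instance * (pform * list nat))%type.

Lemma arith_ACL n :
  arith true (S (S n)) (fun x : query => ACL n (iM (fst x)) (snd x)).
Proof.
  apply (arith_ext _ _ _ (fun x : query =>
    pwf (iL (fst x)) (fst (snd x)) /\ bool_comb (Sigma_form n) (body (fst (snd x))) /\
    has_type (iM (fst x)) (map var_sort (pxs (fst (snd x)))) (snd (snd x)) /\
    Finite (list nat) (fun ys => rank (body (fst (snd x))) <= n /\
      holds (iM (fst x)) (fst (snd x)) (snd (snd x)) ys))).
  { intros [i [p xs]]. cbn [fst snd ACL]. split; intros (H1 & H2 & H3 & H4);
      (repeat split; try assumption; try apply H1);
      pose proof (rank_bool_comb n _ H2); apply finite_listed;
      apply finite_listed in H4 as [l Hl]; exists l; intuition. }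
  apply arith_and; [| apply arith_and; [apply arith_decid | apply arith_and;
    [apply arith_decid |]]].
  - apply (arith_app _ _ _ (fun x : query => (fst x, fst (snd x))) (arith_pwf true n)). comp.
  - apply (decid_app (bool_comb (Sigma_form n))); [| comp].
    apply decid_bool_comb, decid_Sigma_Pi.
  - apply decid_tuple_type; comp.
  - apply (arith_finite n (fun x : query => fst x)); comp.
Qed.

Lemma arith_DCL b n :
  arith b (S (S n)) (fun x : query => DCL n (iM (fst x)) (snd x)).
Proof.
  apply (arith_ext _ _ _ (fun x : query =>
    pwf (iL (fst x)) (fst (snd x)) /\ bool_comb (Sigma_form n) (body (fst (snd x))) /\
    has_type (iM (fst x)) (map var_sort (pxs (fst (snd x)))) (snd (snd x)) /\
    exists! ys, rank (body (fst (snd x))) <= n /\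
      holds (iM (fst x)) (fst (snd x)) (snd (snd x)) ys)).
  { intros [i [p xs]]. cbn [fst snd DCL]. split; intros (H1 & H2 & H3 & (ys & Hys & Hu));
      (split; [assumption |]; split; [assumption |]; split; [assumption |]);
      pose proof (rank_bool_comb n _ H2); exists ys; split; intuition. }
  apply arith_and; [| apply arith_and; [apply arith_decid | apply arith_and;
    [apply arith_decid |]]].
  - apply (arith_app _ _ _ (fun x : query => (fst x, fst (snd x))) (arith_pwf b n)). comp.
  - apply (decid_app (bool_comb (Sigma_form n))); [| comp].
    apply decid_bool_comb, decid_Sigma_Pi.
  - apply decid_tuple_type; comp.
  - apply (arith_unique n (fun x : query => fst x)); comp.
Qed.

(** * Closure operators *)

(** In a step [(b, (p, (xs, ys)))] the element [b] is derived as an entry of the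
    solution [ys] of [p] with parameters [xs]. *)
Local Notation cl_step := (nat * (pform * (list nat * list nat)))%type.

Section Derivations.
Context {L : language} (Phi : pform -> Prop) (M : structure L)
  (B : nat -> Prop) (S : option nat -> Prop).

(** The decidable part of the correctness of a derivation, which is listed latest
    step first; the other part is that [step_holds] is true of the steps. *)
Fixpoint derivation (d : list cl_step) : Prop :=
  match d with
  | [] => True
  | (b, (p, (xs, ys))) :: d' =>
      Phi p /\ has_type M (map var_sort (pxs p)) xs /\ In b ys /\
      Forall (fun x => B x \/ In x (map fst d')) xs /\ derivation d'
  end.

Definition step_holds (s : cl_step) : Prop :=
  let (p, q) := snd s in
  card_in (holds M p (fst q)) S /\ holds M p (fst q) (snd q).

Lemma derivation_app d1 d2 :
  derivation d1 -> derivation d2 -> derivation (d1 ++ d2).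
Proof.
  intros H1 H2. induction d1 as [| [b [p [xs ys]]] d1 IH]; [assumption |].
  destruct H1 as (HP & Ht & Hb & Hx & Hd). simpl. repeat split; auto.
  rewrite map_app. eapply Forall_impl; [| exact Hx]. intros x. cbn beta.
  rewrite in_app_iff. tauto.
Qed.

Lemma cl_iter_mono m m' b :
  m <= m' -> cl_iter Phi M m B S b -> cl_iter Phi M m' B S b.
Proof. intros Hm Hb. induction Hm; [assumption | now left]. Qed.

(** Iterating the one-step closure amounts to concatenating derivations.
    Conversely, a derivation uses only finitely many stages of the iteration. *)
Lemma cl_derivation b :
  cl Phi M B S b <->
  B b \/ exists d, derivation d /\ Forall step_holds d /\ In b (map fst d).
Proof.
  split.
  - intros [m Hm]. revert b Hm. induction m as [| m IH]; intros b Hb; [now left |].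
    destruct Hb as [Hb | (p & xs & ys & HP & Ht & Hx & Hc & Hb & Hh)]; [now apply IH |].
    right. enough (exists d, derivation d /\ Forall step_holds d /\
      Forall (fun x => B x \/ In x (map fst d)) xs) as (d & Hd & Hs & Hxd).
    { exists ((b, (p, (xs, ys))) :: d). simpl. repeat split; auto.
      constructor; [now split | assumption]. }
    clear Ht Hc Hh. induction Hx as [| x xs Hx _ (d & Hd & Hs & Hxd)].
    + exists []. repeat split; constructor.
    + destruct (IH x Hx) as [Bx | (d' & Hd' & Hs' & Hx')].
      * exists d. repeat split; auto.
      * exists (d' ++ d). split; [now apply derivation_app |].
        split; [now apply Forall_app |]. rewrite map_app. constructor.
        -- right. apply in_app_iff. now left.
        -- eapply Forall_impl; [| exact Hxd]. intros y. cbn beta. rewrite in_app_iff. tauto.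
  - intros [Hb | (d & Hd & Hs & Hb)]; [now exists 0 |].
    enough (HC : exists m, forall x, In x (map fst d) -> cl_iter Phi M m B S x).
    { destruct HC as [m Hm]. exists m. now apply Hm. }
    clear b Hb. induction d as [| [b [p [xs ys]]] d IH]; [now exists 0 |].
    destruct Hd as (HP & Ht & Hb & Hx & Hd). apply Forall_cons_iff in Hs as [[Hc Hh] Hs'].
    destruct (IH Hd Hs') as [m Hm]. exists (Datatypes.S m). intros x [<- | Hi].
    + right. exists p, xs, ys. repeat split; try assumption; try apply Hh.
      eapply Forall_impl; [| exact Hx]. intros y [By | Hy].
      * apply (cl_iter_mono 0); [lia | assumption].
      * now apply Hm.
    + left. now apply Hm.
Qed.

End Derivations.

(** The inputs on which closure operators are to be uniform: the code of an input
    consists of the code of the structure and the index of the set of formulas. *)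
Record family (n : nat) : Type := {
  f_inst : instance;
  f_index : nat;
  f_Phi : pform -> Prop;
  f_spec : codes_formulas n f_index (iL f_inst) f_Phi
}.
Arguments f_inst {n}.
Arguments f_index {n}.
Arguments f_Phi {n}.
Arguments f_spec {n}.

#[export] Instance enc_family n : Enc (family n) :=
  fun f => pr (code (f_inst f)) (f_index f).

Lemma comp_f_inst n {A} `{Enc A} (f : A -> family n) :
  comp total f -> comp total (fun a => f_inst (f a)).
Proof.
  intros Hf. apply (comp_fst total (fun a => (f_inst (f a), f_index (f a)))).
  apply (comp_code total f); [reflexivity | assumption].
Qed.

Lemma decid_f_Phi n {A} `{Enc A} (f : A -> family n) (p : A -> pform) :
  comp total f -> comp total p -> decid (fun a => f_Phi (f a) (p a)).
Proof.
  intros Hf Hp.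
  apply (decid_ext _ (fun a => coded code_pform (f_Phi (f a)) (code (p a)))).
  - intros a. split.
    + intros Ha. now exists (p a).
    + intros [p' [Hp' E]]. apply (code_inj (p a) p') in E. now rewrite E.
  - apply (decid_oracle (fun a => f_index (f a)) (fun a => code (p a))
      (fun a => coded code_pform (f_Phi (f a)))).
    + apply (comp_snd total (fun a => (f_inst (f a), f_index (f a)))).
      apply (comp_code total f); [reflexivity | assumption].
    + now apply comp_encoding.
    + intros a. apply (f_spec (f a)).
Qed.

(** ** Canonical indices of finite sets *)

Lemma comp_odd {A} `{Enc A} (D : A -> Prop) (f : A -> nat) :
  comp D f -> comp D (fun x => Nat.odd (f x)).
Proof.
  apply (comp_app D Nat.odd).
  pose proof (comp_natrec (fun _ : nat => false) (fun x => negb (snd (snd x)))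
    ltac:(comp) ltac:(comp)) as R.
  eapply comp_ext; [| apply (comp_app _ _ (fun x : nat => (x, x)) R); comp].
  intros k _. cbn [fst snd]. induction k as [| k IH]; [reflexivity |].
  rewrite Nat.odd_succ, <- Nat.negb_odd. cbn [nat_rect]. now rewrite IH.
Qed.

Lemma comp_div2 {A} `{Enc A} (D : A -> Prop) (f : A -> nat) :
  comp D f -> comp D (fun x => Nat.div2 (f x)).
Proof.
  apply (comp_app D Nat.div2).
  pose proof (comp_odd total (fun x : nat * (nat * nat) => fst (snd x)) ltac:(comp)).
  pose proof (comp_natrec (fun _ : nat => 0)
    (fun x => if Nat.odd (fst (snd x)) then S (snd (snd x)) else snd (snd x))
    ltac:(comp) ltac:(comp)) as R.
  eapply comp_ext; [| apply (comp_app _ _ (fun x : nat => (x, x)) R); comp].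
  intros k _. cbn [fst snd]. induction k as [| k IH]; [reflexivity |].
  cbn [nat_rect]. rewrite <- IH. pose proof (Nat.div2_odd k) as E1.
  pose proof (Nat.div2_odd (S k)) as E2. rewrite Nat.odd_succ, <- Nat.negb_odd in E2.
  destruct (Nat.odd k); cbn [Nat.b2n negb] in *; lia.
Qed.

(** The bit of [u] at position [x] is the parity of [u] halved [x] times. *)
Lemma decid_canonical {A} `{Enc A} (u x : A -> nat) :
  comp total u -> comp total x -> decid (fun a => canonical (u a) (x a)).
Proof.
  intros Hu Hx.
  apply (decid_app (fun p : nat * nat => canonical (fst p) (snd p))
           (fun a => (u a, x a))); [| comp].
  apply decid_is_true.
  pose proof (comp_div2 total (fun x : nat * (nat * nat) => snd (snd x)) ltac:(comp)).
  pose proof (comp_natrec (fun u : nat => u)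
    (fun x => Nat.div2 (snd (snd x))) ltac:(comp) ltac:(comp)) as R.
  apply comp_odd in R. eapply comp_ext; [| exact R].
  intros [v k] _. cbn [fst snd].
  enough (E : nat_rect (fun _ => nat) v (fun _ r => Nat.div2 r) k = Nat.iter k Nat.div2 v).
  { rewrite E. revert v E. induction k as [| k IH]; intros v _; [reflexivity |].
    rewrite Nat.iter_succ_r, <- IH; [reflexivity |].
    clear. induction k; simpl; congruence. }
  induction k; simpl; congruence.
Qed.

(** ** The complexity of closure *)

Local Notation member n := (family n * (nat * nat))%type.

(** The steps of a derivation are Sigma_(n+2) conditions, in number bounded by the
    length of the derivation, so that their conjunction is again Sigma_(n+2); the
    rest of the definition of a derivation is decidable. *)
Lemma arith_cl n (S : option nat -> Prop) :
  arith true (Datatypes.S (Datatypes.S n))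
    (fun x : instance * (pform * list nat) => card_in (fun ys => rank (body (fst (snd x))) <= n /\
       holds (iM (fst x)) (fst (snd x)) (snd (snd x)) ys) S) ->
  arith true (Datatypes.S (Datatypes.S n))
    (fun x : member n =>
       (forall y, canonical (snd (snd x)) y -> dom (iM (f_inst (fst x))) y) /\
       cl (f_Phi (fst x)) (iM (f_inst (fst x))) (canonical (snd (snd x))) S (fst (snd x))).
Proof.
  intros HS.
  assert (Hinst : forall E (EE : Enc E), comp total (fun z : family n * E => f_inst (fst z))).
  { intros E EE. apply (comp_f_inst n (fun z : family n * E => fst z)). comp. }
  apply arith_and.
  - apply (arith_le _ 2); [lia |]. apply (arith_succ false).
    apply (arith_forall 0 (fun (x : member n) y =>
      canonical (snd (snd x)) y -> dom (iM (f_inst (fst x))) y)).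
    apply arith_decid, decid_imp.
    + apply (decid_canonical (fun z : member n * nat => snd (snd (fst z))) snd); comp.
    + apply (decid_dom (fun z : member n * nat => f_inst (fst (fst z)))); [| comp].
      apply (comp_f_inst n (fun z : member n * nat => fst (fst z))). comp.
  - (* Satisfaction has a bounded complexity on formulas of bounded rank only;
       the formulas of a derivation, being in [f_Phi], are of this kind. *)
    set (true_step := fun (f : family n) (s : cl_step) =>
      card_in (fun ys => rank (body (fst (snd s))) <= n /\
        holds (iM (f_inst f)) (fst (snd s)) (fst (snd (snd s))) ys) S /\
      rank (body (fst (snd s))) <= n /\
      holds (iM (f_inst f)) (fst (snd s)) (fst (snd (snd s))) (snd (snd (snd s)))).
    apply (arith_ext _ _ _ (fun x : member n =>
      canonical (snd (snd x)) (fst (snd x)) \/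
      exists d, derivation (f_Phi (fst x)) (iM (f_inst (fst x)))
                  (canonical (snd (snd x))) d /\
                Forall (true_step (fst x)) d /\ In (fst (snd x)) (map fst d))).
    { intros [f [b u]]. cbn [fst snd]. rewrite cl_derivation.
      enough (E : forall d, derivation (f_Phi f) (iM (f_inst f)) (canonical u) d ->
        (Forall (step_holds (iM (f_inst f)) S) d <-> Forall (true_step f) d)).
      { split; (intros [Hb | (d & Hd & Hs & Hb)]; [now left | right; exists d]);
          (split; [assumption |]; split; [now apply (E d Hd) | assumption]). }
      induction d as [| [c [p [xs ys]]] d IH]; [split; constructor |].
      intros (HP & _ & _ & _ & Hd). rewrite !Forall_cons_iff, (IH Hd).
      assert (Hr : rank (body p) <= n).
      { pose proof (rank_quantifier_rank (body p)).
        destruct (proj2 (f_spec f) p HP). lia. }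
      unfold step_holds, true_step. cbn [fst snd].
      rewrite (ensemble_ext (fun ys => rank (body p) <= n /\ _)
                 (holds (iM (f_inst f)) p xs)) by tauto.
      tauto. }
    apply arith_or.
    { apply arith_decid, (decid_canonical (fun x : member n => snd (snd x))); comp. }
    apply (arith_exists (Datatypes.S n) (fun (x : member n) d =>
      derivation _ _ (canonical (snd (snd x))) d /\ _ /\ In (fst (snd x)) (map fst d))).
    apply arith_and; [apply arith_decid | apply arith_and; [| apply arith_decid]].
    + set (G := fun x : (family n * nat) * (cl_step * (list cl_step * bool)) =>
        let f := fst (fst x) in let s := fst (snd x) in
        f_Phi f (fst (snd s)) /\
        has_type (iM (f_inst f)) (map var_sort (pxs (fst (snd s)))) (fst (snd (snd s))) /\
        In (fst s) (snd (snd (snd s))) /\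
        Forall (fun y => canonical (snd (fst x)) y \/ In y (map fst (fst (snd (snd x)))))
          (fst (snd (snd s))) /\ snd (snd (snd x)) = true).
      apply (decid_app (fun p : (family n * nat) * list cl_step =>
        derivation (f_Phi (fst (fst p))) (iM (f_inst (fst (fst p))))
          (canonical (snd (fst p))) (snd p))
        (fun x : member n * list cl_step => ((fst (fst x), snd (snd (fst x))), snd x)));
        [| comp].
      apply (decid_list_rec (fun (z : family n * nat) d =>
        derivation (f_Phi (fst z)) (iM (f_inst (fst z))) (canonical (snd z)) d)
        (fun _ => True) G).
      * apply decid_const.
      * unfold G. cbv zeta. repeat apply decid_and.
        -- apply (decid_f_Phi n (fun x : (family n * nat) * (cl_step * (list cl_step * bool)) =>
             fst (fst x))); comp.
        -- apply (decid_tuple_type (fun x : (family n * nat) * (cl_step * (list cl_step * bool)) =>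
             f_inst (fst (fst x)))); [| comp ..].
           apply (comp_f_inst n (fun x : (family n * nat) * (cl_step * (list cl_step * bool)) =>
             fst (fst x))). comp.
        -- dec.
        -- apply (decid_Forall (fun (x : (family n * nat) * (cl_step * (list cl_step * bool))) y =>
             canonical (snd (fst x)) y \/ In y (map fst (fst (snd (snd x)))))); [| comp].
           apply decid_or.
           ++ apply decid_canonical; comp.
           ++ apply decid_In; [comp |].
              apply (comp_map total (fun _ (s : cl_step) => fst s)); comp.
        -- dec.
      * intros [f u]. reflexivity.
      * intros [f u] [b [p [xs ys]]] d. unfold G. cbn [fst snd derivation].
        now rewrite truth_true.
    + apply (arith_app _ _ (fun z : family n * list cl_step =>
        Forall (true_step (fst z)) (snd z))
        (fun x : member n * list cl_step => (fst (fst x), snd x))); [| comp].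
      apply (arith_Forall true (Datatypes.S (Datatypes.S n)) true_step).
      apply arith_and.
      * apply (arith_app _ _ _ (fun z : family n * cl_step =>
          (f_inst (fst z), (fst (snd (snd z)), fst (snd (snd (snd z)))))) HS).
        pose proof (Hinst cl_step _). comp.
      * apply (arith_succ true).
        apply (arith_holds true n (fun z : family n * cl_step => f_inst (fst z))); [| comp ..].
        apply Hinst.
    + apply (decid_In (fun x : member n * list cl_step => fst (snd (fst x)))); [comp |].
      apply (comp_map total (fun _ (s : cl_step) => fst s)); comp.
Qed.

Lemma arith_acl_pairs n :
  arith true (S (S n)) (fun x : member n =>
    acl_pairs (f_Phi (fst x)) (iM (f_inst (fst x))) (snd x)).
Proof.
  eapply arith_ext; [| apply (arith_cl n (fun k => k <> None))].
  - intros [f [b u]]. reflexivity.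
  - eapply arith_ext; [intros x; apply card_in_finite |].
    apply (arith_finite n (fun x : query => fst x)); comp.
Qed.

Lemma arith_dcl_pairs n :
  arith true (S (S n)) (fun x : member n =>
    dcl_pairs (f_Phi (fst x)) (iM (f_inst (fst x))) (snd x)).
Proof.
  eapply arith_ext; [| apply (arith_cl n (fun k => k = Some 1))].
  - intros [f [b u]]. reflexivity.
  - eapply arith_ext; [intros x; apply card_in_one |].
    apply (arith_unique n (fun x : query => fst x)); comp.
Qed.

(** * Indices of sets of codes *)

(** A number belongs to a set of codes if and only if it is the code of its own
    decoding and that decoding has the property in question. *)
Lemma arith_coded_index b k {J X} `{Enc J} `{Dec X} (cd : X -> nat)
  (R : J -> X -> Prop) :
  (forall t, cd t = code t) ->
  arith b k (fun p : J * X => R (fst p) (snd p)) ->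
  exists U, forall j, exists e, runs U (code j) e /\
    if b then Sigma_index k e (coded cd (R j)) else Pi_index k e (coded cd (R j)).
Proof.
  intros Ecd HR.
  apply (arith_index k b (fun p : J * nat => coded cd (R (fst p)) (snd p))
           (fun j x => (j, x))); [| comp].
  apply (arith_ext _ _ _ (fun p : J * nat =>
    snd p = code (decode (A := X) (snd p)) /\ R (fst p) (decode (snd p)))).
  - intros [j x]. cbn [fst snd]. split.
    + intros [t [Ht ->]]. now rewrite Ecd, decode_code.
    + intros [E Ht]. exists (decode x). now rewrite Ecd.
  - assert (Hd : comp total (fun p : J * nat => decode (A := X) (snd p))).
    { apply comp_decode. comp. }
    apply arith_and.
    + apply arith_decid, decid_eq; [comp | now apply comp_encoding].
    + apply (arith_app _ _ _ (fun p : J * nat => (fst p, decode (snd p))) HR). comp.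
Qed.

Theorem corollary5p2 (n : nat) :
  (exists u, forall c (L : language) (M : structure L), codes c M ->
     exists e, computes u c e /\
       Sigma_index (n + 2) e (coded code_instance (ACL n M))) /\
  (exists u, forall c (L : language) (M : structure L), codes c M ->
     exists e, computes u c e /\
       Delta_index (n + 2) e (coded code_instance (DCL n M))) /\
  (exists u, forall c (L : language) (M : structure L), codes c M ->
     forall q (Phi : pform -> Prop), codes_formulas n q L Phi ->
     exists e, computes u (pr c q) e /\
       Sigma_index (n + 2) e (coded Cantor.to_nat (acl_pairs Phi M))) /\
  (exists u, forall c (L : language) (M : structure L), codes c M ->
     forall q (Phi : pform -> Prop), codes_formulas n q L Phi ->
     exists e, computes u (pr c q) e /\
       Sigma_index (n + 2) e (coded Cantor.to_nat (dcl_pairs Phi M))).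
Proof.
  replace (n + 2) with (S (S n)) by lia.
  assert (Ei : forall t : pform * list nat, code_instance t = code t).
  { intros [p xs]. unfold code_instance. now rewrite code_list_code. }
  assert (Ep : forall t : nat * nat, Cantor.to_nat t = code t) by now intros [a u].
  repeat split.
  - destruct (arith_coded_index _ _ code_instance (fun i => ACL n (iM i)) Ei (arith_ACL n))
      as [U HU].
    exists (code_prog U).
    apply (codes_instance (fun c L M => exists e, computes (code_prog U) c e /\
      Sigma_index (S (S n)) e (coded code_instance (ACL n M)))).
    intros i. destruct (HU i) as [e [He Hs]]. exists e. split; [now exists U | exact Hs].
  - destruct (arith_coded_index _ _ code_instance (fun i => DCL n (iM i)) Ei
      (arith_DCL true n)) as [U HU].
    destruct (arith_coded_index _ _ code_instance (fun i => DCL n (iM i)) Ei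
      (arith_DCL false n)) as [V HV].
    exists (code_prog (PPair U V)).
    apply (codes_instance (fun c L M => exists e, computes (code_prog (PPair U V)) c e /\
      Delta_index (S (S n)) e (coded code_instance (DCL n M)))).
    intros i. destruct (HU i) as [e1 [He1 Hs1]], (HV i) as [e2 [He2 Hs2]].
    exists (pr e1 e2). split; [| now exists e1, e2].
    exists (PPair U V). split; [reflexivity | now constructor].
  - destruct (arith_coded_index _ _ Cantor.to_nat
      (fun f => acl_pairs (f_Phi f) (iM (f_inst f))) Ep (arith_acl_pairs n)) as [U HU].
    exists (code_prog U).
    apply (codes_instance (fun c L M => forall q Phi, codes_formulas n q L Phi ->
      exists e, computes (code_prog U) (pr c q) e /\
      Sigma_index (S (S n)) e (coded Cantor.to_nat (acl_pairs Phi M)))).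
    intros i q Phi HPhi.
    destruct (HU {| f_inst := i; f_index := q; f_Phi := Phi; f_spec := HPhi |})
      as [e [He Hs]].
    exists e. split; [now exists U | exact Hs].
  - destruct (arith_coded_index _ _ Cantor.to_nat
      (fun f => dcl_pairs (f_Phi f) (iM (f_inst f))) Ep (arith_dcl_pairs n)) as [U HU].
    exists (code_prog U).
    apply (codes_instance (fun c L M => forall q Phi, codes_formulas n q L Phi ->
      exists e, computes (code_prog U) (pr c q) e /\
      Sigma_index (S (S n)) e (coded Cantor.to_nat (dcl_pairs Phi M)))).
    intros i q Phi HPhi.
    destruct (HU {| f_inst := i; f_index := q; f_Phi := Phi; f_spec := HPhi |})
      as [e [He Hs]].
    exists e. split; [now exists U | exact Hs].
Qed.
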